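(* Let $\mathbb{K}$ be a field and let $G$ be a forest with vertex set $V(G)=\{x_1,\ldots,x_n\}$. Let $R=\mathbb{K}[x_1,\ldots,x_n]$, let $NI(G)\subseteq R$ be the closed neighborhood ideal of $G$, and let $a_G$ be the matching number of $G$. Then $\mathrm{reg}(R/NI(G))=a_G$.
   Context: All graphs are finite and simple. A forest is a graph without any cycle (not necessarily connected). For a vertex $w$ of $G$, $N_G[w]$ denotes the closed neighborhood of $w$, i.e. $w$ together with all vertices adjacent to $w$. The vertices of $G$ are identified with the variables of the polynomial ring $R=\mathbb{K}[x_1,\ldots,x_n]$ (standard grading, each variable of degree 1). For $w\in V(G)$ put $m_{(G,w)}=\prod_{x_i\in N_G[w]}x_i$. The closed neighborhood ideal is $NI(G)=\langle m_{(G,w)} : w\in V(G)\rangle$. A matching of $G$ is a set of pairwise disjoint edges; the matching number $a_G$ is the maximum size of a matching. For a monomial ideal $I\subseteq R$, $\mathrm{reg}(R/I)=\max\{j-i:\beta_{i,j}(R/I)\neq 0\}$ is the Castelnuovo-Mumford regularity, where $\beta_{i,j}(R/I)$ are the graded Betti numbers in the graded minimal free resolution of $R/I$ over $R$. *)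

(* Defs.v *)
From HB Require Import structures.
From mathcomp Require Import all_boot all_order all_algebra.
From mathcomp Require Import mpoly.

Set Implicit Arguments.
Unset Strict Implicit.
Unset Printing Implicit Defensive.

Import GRing.Theory Num.Theory.
Local Open Scope ring_scope.

(* A finite simple graph on a finType T is a symmetric irreflexive e : rel T. *)

(* In a simple graph, the cycles are the closed walks with pairwise distinct
   vertices and at least 3 of them; [:: x; y] with e x y is also a [ucycle],
   hence the size condition. *)
Definition is_forest (T : finType) (e : rel T) : Prop :=
  forall c : seq T, (2 < size c)%N -> ~ ucycle e c.

Definition edges (T : finType) (e : rel T) : {set {set T}} :=
  [set [set p.1; p.2] | p : T * T & e p.1 p.2].

Definition is_matching (T : finType) (e : rel T) (M : {set {set T}}) : bool :=
  (M \subset edges e) && trivIset M.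

Definition matching_number (T : finType) (e : rel T) : nat :=
  \max_(M : {set {set T}} | is_matching e M) #|M|.

Definition closed_nbhd (T : finType) (e : rel T) (w : T) : {set T} :=
  w |: [set v | e w v].

Definition nbhd_monomial (K : fieldType) (n : nat) (e : rel 'I_n) (w : 'I_n) :
    {mpoly K[n]} :=
  \prod_(i in closed_nbhd e w) 'X_i.

Definition ideal_gen (R : comNzRingType) (T : finType) (g : T -> R) (f : R) :
    Prop :=
  exists a : T -> R, f = \sum_(t : T) a t * g t.

Definition closed_nbhd_ideal (K : fieldType) (n : nat) (e : rel 'I_n) :
    {mpoly K[n]} -> Prop :=
  ideal_gen (nbhd_monomial K e).
Arguments closed_nbhd_ideal K {n} e _.

(* p lies in the component of degree z of K[x_1, .., x_n], which is 0 when z is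
   negative. *)
Definition in_degree (K : fieldType) (n : nat) (z : int) (p : {mpoly K[n]}) :
    Prop :=
  match z with
  | Posz d => p \is d.-homog
  | Negz _ => p = 0
  end.

(* A graded minimal free resolution
     ... -> F_2 -> F_1 -> F_0 -> R/I -> 0,     R = K[x_1, .., x_n].
   F_i is the sum over k of R(- res_shift i k): its elements are row vectors and
   its k-th basis vector has degree res_shift i k. The map F_(i+1) -> F_i is
   v |-> v *m res_diff i. A graded map F_0 -> R/I is given by the images of the
   basis vectors, which lift to homogeneous elements of R: they are the entries
   of res_aug, and F_0 -> R/I is v |-> v *m res_aug modulo I. Minimality is
   Im (F_(i+1) -> F_i) \subset (x_1, .., x_n) F_i, i.e. the entries of the
   matrices have no constant term. The length is not required to be finite; a
   finite resolution has res_rank i = 0 for i large. *)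
Record min_free_resolution (K : fieldType) (n : nat)
    (I : {mpoly K[n]} -> Prop) := MinFreeResolution {
  res_rank : nat -> nat;
  res_shift : forall i, 'I_(res_rank i) -> int;
  res_diff : forall i, 'M[{mpoly K[n]}]_(res_rank i.+1, res_rank i);
  res_aug : 'cV[{mpoly K[n]}]_(res_rank 0);
  res_aug_graded : forall k, in_degree (@res_shift 0 k) (res_aug k 0);
  res_diff_graded : forall i k l,
    in_degree (@res_shift i.+1 k - @res_shift i l) (res_diff i k l);
  res_aug_surj : forall f : {mpoly K[n]},
    exists v : 'rV[{mpoly K[n]}]_(res_rank 0), I (f - (v *m res_aug) 0 0);
  res_aug_exact : forall v : 'rV[{mpoly K[n]}]_(res_rank 0),
    I ((v *m res_aug) 0 0) <-> exists u, v = u *m res_diff 0;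
  res_diff_exact : forall i (v : 'rV[{mpoly K[n]}]_(res_rank i.+1)),
    v *m res_diff i = 0 <-> exists u, v = u *m res_diff i.+1;
  res_minimal : forall i k l, (res_diff i k l)@_0%MM = 0
}.

Definition betti (K : fieldType) (n : nat) (I : {mpoly K[n]} -> Prop)
    (F : min_free_resolution I) (i : nat) (j : int) : nat :=
  #|[set k : 'I_(res_rank F i) | res_shift k == j]|.

(* reg (R/I) = r. The graded minimal free resolution is unique up to
   isomorphism; the definition does not rely on this fact, as it asks that one
   exists and that all of them give the value r. *)
Definition is_regularity (K : fieldType) (n : nat) (I : {mpoly K[n]} -> Prop)
    (r : int) : Prop :=
  inhabited (min_free_resolution I) /\
  forall F : min_free_resolution I,
    (exists (i : nat) (j : int), betti F i j != 0%N /\ j - i%:Z = r) /\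
    (forall (i : nat) (j : int), betti F i j != 0%N -> j - i%:Z <= r).

(* Main.v *)
(* For a minimal free resolution F of R/I, moving along the rows and columns of
   the double complex Koszul (x) F shows that F_i has a generator of degree j
   exactly when the Koszul homology H_i(x; R/I) is nonzero in degree j; such a
   resolution exists because submodules of R^r are finitely generated (Dickson's
   lemma on leading monomials), hence minimally generated by homogeneous elements.

   Let C be a vertex cover of the forest together with a matching of C into its
   complement, so that #|C| is the matching number.

   Upper bound. For a variable y, the homology of R/I vanishes in coefficient
   degree d if that of R/(I : y) does in degree d - 1 and that of R/(I, y) does in
   degree d. Splitting in this way on the vertices of C leads, for each partition C = A + B, to
   the ideal where the variables of A are 0 and those of B are 1; modulo variables
   it is generated by the products over the neighbors outside C of some w in B,
   and counting edges with a parent function bounds the sum of (degree - 1) over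
   these generators by #|A|. Hence this ideal contributes at most #|A| + #|B| = #|C|.

   Lower bound. The Koszul chain x_C e_(V - C) is a cycle modulo NI(G). It is not a
   boundary: the faces meeting each matching edge in exactly one vertex and
   containing the unmatched vertices are dominating sets and support a cocycle
   (a cross-polytope) which takes the value 1 on it. *)
Require Import Defs.
From HB Require Import structures.
From mathcomp Require Import all_boot all_order all_algebra.
From mathcomp Require Import mpoly ring zify.
From Stdlib Require Import Classical ClassicalEpsilon.

Set Implicit Arguments.
Unset Strict Implicit.
Unset Printing Implicit Defensive.

Import Order.TTheory GRing.Theory Num.Theory.
Local Open Scope ring_scope.

(** * Homogeneous components of polynomials and of matrices *)

Section Homogeneous.
Variables (K : fieldType) (n : nat).
Local Notation R := {mpoly K[n]}.
Implicit Types (p q : R) (m : 'X_{1..n}) (z : int).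

Definition mfilter (P : pred 'X_{1..n}) p : R :=
  \sum_(m <- msupp p | P m) p@_m *: 'X_[m].

Lemma mcoeff_mfilter P p m : (mfilter P p)@_m = if P m then p@_m else 0.
Proof.
rewrite /mfilter raddf_sum /=.
under eq_bigr do rewrite mcoeffZ mcoeffX.
have [m_p|m_p] := boolP (m \in msupp p); last first.
  rewrite (memN_msupp_eq0 m_p) if_same big_seq_cond big1 // => k /andP[k_p _].
  by case: eqP k_p m_p => [-> ->|_]; rewrite ?mulr0.
case: ifP => Pm.
  rewrite big_mkcond (bigD1_seq m) ?msupp_uniq //= Pm eqxx mulr1 big1 ?addr0 //.
  by move=> k /negPf ->; rewrite mulr0 if_same.
rewrite big1 // => k Pk; case: eqP => [km|]; rewrite ?mulr0 //.
by rewrite km Pm in Pk.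
Qed.

Lemma mcoeffMvar i p m :
  ('X_i * p)@_m = if (0 < m i)%N then p@_(m - U_(i))%MM else 0.
Proof.
rewrite mulrC; case: ifP => [m_i|].
  have le_im: (U_(i) <= m)%MM by rewrite lep1mP -lt0n.
  by rewrite -{1}(submK le_im) addmC mcoeffMX.
move=> m_i; apply: memN_msupp_eq0; rewrite (perm_mem (msuppMX _ _)).
by apply: contraFN m_i => /mapP[k _ ->]; rewrite mnmDE mnm1E eqxx.
Qed.

Definition mdivX i p : R :=
  \sum_(m <- msupp p | (0 < m i)%N) p@_m *: 'X_[m - U_(i)].

Lemma mcoeff_mdivX i p m : (mdivX i p)@_m = p@_(m + U_(i))%MM.
Proof.
transitivity (('X_i * mdivX i p)@_(m + U_(i))%MM).
  by rewrite mcoeffMvar mnmDE mnm1E eqxx addn1 addmK.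
suff -> : 'X_i * mdivX i p = mfilter (fun m => (0 < m i)%N) p.
  by rewrite mcoeff_mfilter mnmDE mnm1E eqxx addn1.
rewrite /mdivX /mfilter mulr_sumr; apply: eq_bigr => k k_i.
have le_ik: (U_(i) <= k)%MM by rewrite lep1mP -lt0n.
by rewrite -scalerAr -mpolyXD addmC submK.
Qed.

Lemma in_degreeP z p :
  in_degree z p <-> forall m, p@_m != 0 -> (mdeg m)%:Z = z.
Proof.
case: z => d /=; split.
- move/dhomogP=> hp m; rewrite -mcoeff_msupp => /hp /= <-; by [].
- move=> hp; apply/dhomogP => m; rewrite mcoeff_msupp => /hp [].
  by [].
- by move=> -> m; rewrite mcoeff0 eqxx.
move=> hp; apply/mpolyP => m; rewrite mcoeff0; apply/eqP/negbNE/negP.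
by move/hp.
Qed.

Definition hpart z p : R := mfilter (fun m => (mdeg m)%:Z == z) p.

Lemma mcoeff_hpart z p m :
  (hpart z p)@_m = if (mdeg m)%:Z == z then p@_m else 0.
Proof. exact: mcoeff_mfilter. Qed.

Fact hpart_is_additive z : additive (hpart z).
Proof.
move=> p q; apply/mpolyP => m; rewrite mcoeffB !mcoeff_hpart mcoeffB.
by case: ifP => //; rewrite subr0.
Qed.
HB.instance Definition _ z := GRing.isAdditive.Build R R (hpart z) (hpart_is_additive z).

Lemma hpart_in_degree z p : in_degree z (hpart z p).
Proof.
by apply/in_degreeP => m; rewrite mcoeff_hpart; case: ifP => [/eqP|]; rewrite ?eqxx.
Qed.

Lemma hpart_id z p : in_degree z p -> hpart z p = p.
Proof.
move/in_degreeP=> hp; apply/mpolyP => m; rewrite mcoeff_hpart.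
by case: ifP => // /negP m_z; apply/esym/eqP/negbNE/negP => /hp/eqP.
Qed.

Lemma hpartM y z p q : in_degree y p -> hpart (y + z) (p * q) = p * hpart z q.
Proof.
move/in_degreeP=> hp; apply/mpolyP => m.
rewrite mcoeff_hpart !mcoeffM; case: ifP => m_yz.
  apply: eq_bigr => k /eqP mk; rewrite mcoeff_hpart.
  have [->|/hp k1y] := eqVneq (p@_k.1) 0; first by rewrite !mul0r.
  have dm : (mdeg m)%:Z = y + (mdeg k.2)%:Z by rewrite -k1y -PoszD -mdegD -mk.
  by move: m_yz; rewrite dm (inj_eq (addrI y)) => ->.
apply/esym/big1 => k /eqP mk; rewrite mcoeff_hpart.
have [->|/hp k1y] := eqVneq (p@_k.1) 0; first by rewrite !mul0r.
case: ifP => // /eqP k2z; last by rewrite mulr0.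
have dm : (mdeg m)%:Z = y + (mdeg k.2)%:Z by rewrite -k1y -PoszD -mdegD -mk.
by rewrite dm k2z eqxx in m_yz.
Qed.

Lemma in_degreeD z p q : in_degree z p -> in_degree z q -> in_degree z (p + q).
Proof. by move=> hp hq; rewrite -(hpart_id hp) -(hpart_id hq) -raddfD; apply: hpart_in_degree. Qed.

Lemma in_degreeN z p : in_degree z p -> in_degree z (- p).
Proof. by move=> hp; rewrite -(hpart_id hp) -raddfN; apply: hpart_in_degree. Qed.

Lemma in_degree0 z : in_degree z (0 : R).
Proof. by rewrite -(raddf0 (hpart z)); apply: hpart_in_degree. Qed.

Lemma in_degree_sum z (I : Type) (r : seq I) (P : pred I) (F : I -> R) :
  (forall i, P i -> in_degree z (F i)) -> in_degree z (\sum_(i <- r | P i) F i).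
Proof.
by move=> hF; apply: (big_ind (in_degree z)) => //; [apply: in_degree0 | apply: in_degreeD].
Qed.

Lemma in_degreeX m : in_degree (mdeg m)%:Z ('X_[m] : R).
Proof. by apply/in_degreeP => k; rewrite mcoeffX; have [->|_] := eqVneq m k; rewrite ?eqxx. Qed.

Lemma in_degree1 : in_degree 0 (1 : R).
Proof.
by apply/in_degreeP => k; rewrite mcoeff1; have [->|_] := eqVneq k 0%MM; rewrite ?mdeg0 ?eqxx.
Qed.

Lemma in_degree_mcoeff0 z p : in_degree z p -> z != 0 -> p@_0%MM = 0.
Proof.
move=> /in_degreeP hp z_neq0; apply/eqP/negbNE/negP => /hp.
by rewrite mdeg0 => z0; rewrite -z0 eqxx in z_neq0.
Qed.

(** Row [i] is the image of a basis vector of degree [t i]: the map [v |-> v *m A] preserves degrees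
    between graded free modules with generator degrees [t] and [s]. *)
Definition gradedmx a b (t : 'I_a -> int) (s : 'I_b -> int) (A : 'M[R]_(a, b)) : Prop :=
  forall i j, in_degree (t i - s j) (A i j).

(** The degree-preserving part of an arbitrary matrix. It commutes with products by graded matrices,
    so a solution of a graded linear equation can be replaced by a homogeneous one. *)
Definition hmx a b (t : 'I_a -> int) (s : 'I_b -> int) (A : 'M[R]_(a, b)) : 'M[R]_(a, b) :=
  \matrix_(i, j) hpart (t i - s j) (A i j).

Lemma hmx_graded a b (t : 'I_a -> int) (s : 'I_b -> int) A : gradedmx t s (hmx t s A).
Proof. by move=> i j; rewrite mxE; apply: hpart_in_degree. Qed.

Lemma hmx_id a b (t : 'I_a -> int) (s : 'I_b -> int) A : gradedmx t s A -> hmx t s A = A.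
Proof. by move=> hA; apply/matrixP => i j; rewrite mxE hpart_id. Qed.

Lemma hmxB a b (t : 'I_a -> int) (s : 'I_b -> int) A B :
  hmx t s (A - B) = hmx t s A - hmx t s B.
Proof. by apply/matrixP => i j; rewrite !mxE raddfB. Qed.

Lemma hmxMr a b c (t : 'I_a -> int) (u : 'I_b -> int) (s : 'I_c -> int)
    (B : 'M[R]_(a, b)) (D : 'M[R]_(b, c)) :
  gradedmx u s D -> hmx t s (B *m D) = hmx t u B *m D.
Proof.
move=> hD; apply/matrixP => i j; rewrite !mxE raddf_sum; apply: eq_bigr => k _ /=.
rewrite mxE [RHS]mulrC -(hpartM _ _ (hD k j)) [D k j * _]mulrC; congr (hpart _ _); lia.
Qed.

Lemma hmxMl a b c (t : 'I_a -> int) (u : 'I_b -> int) (s : 'I_c -> int)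
    (L : 'M[R]_(a, b)) (B : 'M[R]_(b, c)) :
  gradedmx t u L -> hmx t s (L *m B) = L *m hmx u s B.
Proof.
move=> hL; apply/matrixP => i j; rewrite !mxE raddf_sum; apply: eq_bigr => k _ /=.
rewrite mxE -(hpartM _ _ (hL i k)); congr (hpart _ _); lia.
Qed.

Lemma gradedmxM a b c (t : 'I_a -> int) (u : 'I_b -> int) (s : 'I_c -> int)
    (A : 'M[R]_(a, b)) (B : 'M[R]_(b, c)) :
  gradedmx t u A -> gradedmx u s B -> gradedmx t s (A *m B).
Proof. by move=> hA hB; rewrite -(hmx_id hA) -(hmxMr _ _ hB); apply: hmx_graded. Qed.

(** Reduction modulo (x_1, .., x_n); minimality of a resolution says that it kills every
    differential. *)
Definition consts a b (A : 'M[R]_(a, b)) : 'M[K]_(a, b) := map_mx (mcoeff 0%MM) A.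

Lemma consts0P a b (A : 'M[R]_(a, b)) : consts A = 0 <-> forall i j, (A i j)@_0%MM = 0.
Proof.
split=> [/matrixP A0 i j|A0]; first by move: (A0 i j); rewrite !mxE.
by apply/matrixP => i j; rewrite !mxE A0.
Qed.

Lemma constsD a b (A B : 'M[R]_(a, b)) : consts (A + B) = consts A + consts B.
Proof. exact: map_mxD. Qed.

Lemma constsM a b c (A : 'M[R]_(a, b)) (B : 'M[R]_(b, c)) :
  consts (A *m B) = consts A *m consts B.
Proof. exact: map_mxM. Qed.

End Homogeneous.

(** * The Koszul complex and the homotopy for multiplication by a variable *)

Section Koszul.
Variables (K : fieldType) (n : nat) (rho : 'I_n -> nat).
Hypothesis rho_inj : injective rho.
Local Notation R := {mpoly K[n]}.
Local Notation N := #|{: {set 'I_n}}|.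
Implicit Types (u v w y : 'I_n) (Q : {set 'I_n}).

(** The sign of inserting e_v into e_Q for the order [rho]. The order is a parameter because the
    lower bound uses one in which matched vertices are consecutive. *)
Definition ksgn v Q : R := (-1) ^+ #|[set u in Q | (rho u < rho v)%N]|.

Lemma ksgnU v w Q : v \notin Q ->
  ksgn w (v |: Q) = (-1) ^+ (rho v < rho w)%N * ksgn w Q.
Proof.
move=> vQ; rewrite /ksgn -exprD; congr (_ ^+ _).
case: ltnP => vw.
  rewrite (_ : [set u in _ | _] = v |: [set u in Q | (rho u < rho w)%N]).
    by rewrite cardsU1 inE (negPf vQ).
  by apply/setP => u; rewrite !inE; case: eqP => // ->; rewrite vw.
apply: eq_card => u; rewrite !inE; case: eqP => // ->.
by rewrite ltnNge vw !andbF.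
Qed.

Lemma ksgn_sq v Q : ksgn v Q * ksgn v Q = 1.
Proof. by rewrite -expr2 sqrr_sign. Qed.

Lemma ksgn_anti v w Q : v != w -> v \notin Q -> w \notin Q ->
  ksgn v Q * ksgn w (v |: Q) = - (ksgn w Q * ksgn v (w |: Q)).
Proof.
move=> vw vQ wQ; rewrite !ksgnU //.
have : rho v != rho w by rewrite (inj_eq rho_inj).
by case: ltngtP => // _ _; rewrite expr0 expr1; ring.
Qed.

Fact koszul_key : unit. Proof. by []. Qed.
Lemma ksgn_swap v w Q : v != w -> v \notin Q -> w \notin Q ->
  ksgn v (w |: Q) * ksgn w (v |: Q) = - (ksgn w Q * ksgn v Q).
Proof.
move=> vw vQ wQ; rewrite !ksgnU //.
have : rho v != rho w by rewrite (inj_eq rho_inj).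
by case: ltngtP => // _ _; rewrite expr0 expr1; ring.
Qed.

(** Row Q of a matrix [z] is the coefficient of e_Q in a chain with values in R^r. The differential
    multiplies on the left, hence commutes with the matrices of a resolution, which multiply on the
    right. *)
Definition koszul : 'M[R]_N := \matrix[koszul_key]_(i, j)
  \sum_(v | (v \notin enum_val (i : 'I_N)) && (enum_val (j : 'I_N) == v |: enum_val (i : 'I_N)))
     ksgn v (enum_val (i : 'I_N)) * 'X_v.

Fact contract_key : unit. Proof. by []. Qed.
(** The component at Q comes from Q \ y: on chains this is exterior multiplication by e_y. *)
Definition contract y : 'M[R]_N := \matrix[contract_key]_(i, j)
  if (y \in enum_val (i : 'I_N)) && (enum_val (j : 'I_N) == enum_val (i : 'I_N) :\ y)
  then ksgn y (enum_val (j : 'I_N)) else 0.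

Lemma koszulE r (z : 'M[R]_(N, r)) Q l :
  (koszul *m z) (enum_rank Q) l =
  \sum_(v | v \notin Q) ksgn v Q * 'X_v * z (enum_rank (v |: Q)) l.
Proof.
rewrite mxE; under eq_bigr do rewrite mxE enum_rankK mulr_suml big_mkcondr.
rewrite exchange_big /=; apply: eq_bigr => v vQ.
rewrite (bigD1 (enum_rank (v |: Q))) //= enum_rankK eqxx big1 ?addr0 // => j j_neq.
by case: ifP => [/eqP jE|] //; case/eqP: j_neq; rewrite -jE enum_valK.
Qed.

Lemma contractE y r (z : 'M[R]_(N, r)) Q l :
  (contract y *m z) (enum_rank Q) l =
  if y \in Q then ksgn y (Q :\ y) * z (enum_rank (Q :\ y)) l else 0.
Proof.
rewrite mxE (bigD1 (enum_rank (Q :\ y))) //= mxE !enum_rankK eqxx andbT.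
rewrite [X in _ + X]big1 ?addr0 => [|j]; first by case: ifP; rewrite ?mul0r.
rewrite mxE enum_rankK; case: ifP; last by rewrite mul0r.
by case/andP => _ /eqP <-; rewrite enum_valK eqxx.
Qed.

Lemma chainP r (z z' : 'M[R]_(N, r)) :
  (forall Q l, z (enum_rank Q) l = z' (enum_rank Q) l) -> z = z'.
Proof. by move=> h; apply/matrixP => i l; rewrite -(enum_valK i). Qed.

Lemma koszul_sq r (z : 'M[R]_(N, r)) : koszul *m (koszul *m z) = 0.
Proof.
apply: chainP => Q l.
rewrite [RHS]mxE (koszulE (koszul *m z)).
pose F v w := ksgn v Q * ksgn w (v |: Q) * 'X_v * 'X_w * z (enum_rank (w |: (v |: Q))) l.
transitivity (\sum_v \sum_(w | [&& v \notin Q, w \notin Q & v != w]) F v w).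
  rewrite big_mkcond /=; apply: eq_bigr => v _; case: ifP => vQ; last first.
    by rewrite big1 // => w; rewrite ?vQ.
  rewrite koszulE mulr_sumr; apply: eq_big => [w|w _].
    by rewrite !inE negb_or andbC eq_sym.
  by rewrite /F; ring.
(* Exchanging the two deleted vertices pairs the terms with [rho v < rho w] with the other ones,
   with opposite signs. *)
rewrite pair_big_dep /= (bigID (fun p => (rho p.1 < rho p.2)%N)) /=.
rewrite [X in _ + X](reindex_inj (h := fun p : 'I_n * 'I_n => (p.2, p.1))) /=; last first.
  by move=> [a b] [c d] /= [-> ->].
rewrite [X in _ + X](eq_bigl (fun p : 'I_n * 'I_n =>
  [&& p.1 \notin Q, p.2 \notin Q & p.1 != p.2] && (rho p.1 < rho p.2)%N)).
  rewrite -big_split big1 //= => -[v w] /= /andP[/and3P[vQ wQ vw] _].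
  rewrite /F (setUCA [set w]) [ksgn w Q * _]mulrC ksgn_anti //.
  by rewrite mulrC; ring.
move=> [v w] /=; rewrite -leqNgt [v == w]eq_sym.
case vQ: (v \notin Q); case wQ: (w \notin Q) => //=.
by case: eqVneq => //= wv; rewrite ltn_neqAle (inj_eq rho_inj) eq_sym wv.
Qed.

(** If y is not in Q, only the term v = y of the first summand survives. If y is in Q, the term v =
    y of the second summand gives x_y z(Q), and the remaining terms cancel by [ksgn_swap]. *)
Lemma koszul_homotopy y r (z : 'M[R]_(N, r)) :
  koszul *m (contract y *m z) + contract y *m (koszul *m z) = 'X_y *: z.
Proof.
apply: chainP => Q l.
rewrite [LHS]mxE [RHS]mxE.
apply: etrans (congr2 +%R (koszulE _ Q l) (contractE _ _ Q l)) _.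
case: ifPn => yQ; last first.
  rewrite addr0 (bigD1 y) //= contractE setU11 setU1K // big1 ?addr0.
    by rewrite mulrACA mulrA ksgn_sq mul1r.
  move=> v /andP[vQ vy]; rewrite contractE !inE eq_sym (negPf vy) (negPf yQ).
  by rewrite mulr0.
rewrite koszulE [X in _ * X](bigD1 y) ?setD11 //= setD1K // mulrDr !mulrA ksgn_sq mul1r.
rewrite addrCA -[RHS]addr0; congr (_ + _).
rewrite mulr_sumr [X in _ + X](eq_bigl (fun v => v \notin Q)); last first.
  by move=> v; rewrite !inE negb_and negbK; case: eqVneq => [->|_] /=; rewrite ?yQ ?andbT.
rewrite -big_split big1 //= => v vQ.
have vy : v != y by apply: contraNneq vQ => ->.
rewrite contractE !inE yQ orbT.
have -> : (v |: Q) :\ y = v |: (Q :\ y).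
  by apply/setP => u; rewrite !inE; case: (eqVneq u v) => [->|_] //=; rewrite ?vy.
have vQy : v \notin Q :\ y by rewrite !inE negb_and vQ orbT.
have yQy : y \notin Q :\ y by rewrite setD11.
have := ksgn_swap vy vQy yQy; rewrite setD1K // => swap.
transitivity ((ksgn v Q * ksgn y (v |: Q :\ y) + ksgn y (Q :\ y) * ksgn v (Q :\ y))
   * 'X_v * z (enum_rank (v |: Q :\ y)) l); first by ring.
by rewrite swap addNr !mul0r.
Qed.

End Koszul.

(** * Koszul homology modulo a monomial ideal *)

Section MonomialIdeals.
Variables (K : fieldType) (n : nat) (rho : 'I_n -> nat).
Hypothesis rho_inj : injective rho.
Local Notation R := {mpoly K[n]}.
Local Notation N := #|{: {set 'I_n}}|.
Local Notation koszul := (koszul K rho).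
Implicit Types (P : pred 'X_{1..n}) (v y : 'I_n) (Q A : {set 'I_n}).

(** A monomial ideal is encoded by the set [P] of exponents of its monomials; [inI P] is the span of
    these monomials, an ideal when [P] is [upclosed]. *)
Definition upclosed P := forall m k, P m -> P (m + k)%MM.

Definition inI P (f : R) := forall m, ~~ P m -> f@_m = 0.

Definition modI P a b (A : 'M[R]_(a, b)) := forall i j, inI P (A i j).

Lemma inI_sub P P' f : (forall m, P m -> P' m) -> inI P f -> inI P' f.
Proof. by move=> PP' fP m /(contra (PP' m))/fP. Qed.

Lemma inID P f g : inI P f -> inI P g -> inI P (f + g).
Proof. by move=> fP gP m Pm; rewrite mcoeffD fP ?gP ?addr0. Qed.

Lemma inIN P f : inI P f -> inI P (- f).
Proof. by move=> fP m Pm; rewrite mcoeffN fP ?oppr0. Qed.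

Lemma inI0 P : inI P 0.
Proof. by move=> m _; rewrite mcoeff0. Qed.

Lemma inIM P f g : upclosed P -> inI P f -> inI P (g * f).
Proof.
move=> Pup fP m Pm; rewrite mcoeffM big1 // => k /eqP mk.
rewrite [f@__]fP ?mulr0 //; apply: contra Pm => /Pup Pk.
by rewrite mk addmC Pk.
Qed.

Lemma modI_sub P P' a b (A : 'M[R]_(a, b)) :
  (forall m, P m -> P' m) -> modI P A -> modI P' A.
Proof. by move=> PP' AP i j; apply: inI_sub (AP i j). Qed.

Lemma modID P a b (A B : 'M[R]_(a, b)) : modI P A -> modI P B -> modI P (A + B).
Proof. by move=> AP BP i j; rewrite mxE; apply: inID. Qed.

Lemma modIB P a b (A B : 'M[R]_(a, b)) : modI P A -> modI P B -> modI P (A - B).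
Proof. by move=> AP BP; apply: modID => // i j; rewrite mxE; apply: inIN. Qed.

Lemma modIM P a b c (B : 'M[R]_(a, b)) (A : 'M[R]_(b, c)) :
  upclosed P -> modI P A -> modI P (B *m A).
Proof.
move=> Pup AP i j; rewrite mxE; apply: (big_ind (inI P)); first exact: inI0.
  exact: inID.
by move=> k _; apply: inIM.
Qed.

Lemma modI_hmx P a b (t : 'I_a -> int) (s : 'I_b -> int) (A : 'M[R]_(a, b)) :
  modI P A -> modI P (hmx t s A).
Proof. by move=> AP i j m Pm; rewrite mxE mcoeff_hpart AP ?if_same. Qed.

(** The monomials of the ideals (I : x_y) and (I, x_y). *)
Definition colon P y : pred 'X_{1..n} := fun m => P (m + U_(y))%MM.
Definition plus P y : pred 'X_{1..n} := fun m => P m || (0 < m y)%N.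

Lemma modI_var P y a b (A : 'M[R]_(a, b)) :
  modI P ('X_y *: A) <-> modI (colon P y) A.
Proof.
split=> AP i j m Pm.
  by have := AP i j (m + U_(y))%MM Pm; rewrite mxE mcoeffMvar mnmDE mnm1E eqxx addn1 addmK.
rewrite mxE mcoeffMvar; case: ifP => // m_y; apply: AP.
have le_ym: (U_(y) <= m)%MM by rewrite lep1mP -lt0n.
by rewrite /colon submK.
Qed.

Definition divmx y a b (A : 'M[R]_(a, b)) := map_mx (mdivX y) A.

Lemma modI_divmx P y a b (A : 'M[R]_(a, b)) :
  modI (plus P y) A -> modI P (A - 'X_y *: divmx y A).
Proof.
move=> AP i j m Pm; rewrite !mxE mcoeffB mcoeffMvar mcoeff_mdivX.
case: ifP => m_y.
  have le_ym: (U_(y) <= m)%MM by rewrite lep1mP -lt0n.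
  by rewrite submK ?subrr.
by rewrite subr0 AP // /plus negb_or Pm m_y.
Qed.

(** A cycle whose class dies modulo (I, y) is homologous to some x_y v modulo I; then x_y times the
    boundary of v lies in I, so v is a cycle modulo (I : y). *)
Lemma koszul_modI_lift P y (z w : 'cV[R]_N) : upclosed P ->
    modI P (koszul *m z) -> modI (plus P y) (z - koszul *m w) ->
  let c := z - koszul *m w in
  modI P (c - 'X_y *: divmx y c) /\ modI (colon P y) (koszul *m divmx y c).
Proof.
move=> Pup zP zw c; have cP := modI_divmx zw; split=> //.
apply/modI_var; rewrite scalemxAr.
have -> : 'X_y *: divmx y c = c - (c - 'X_y *: divmx y c) by rewrite opprB addrC subrK.
rewrite mulmxBr; apply: modIB; last exact: modIM.
by rewrite /c mulmxBr koszul_sq // subr0.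
Qed.

(* Multiplication by a variable is null-homotopic on the Koszul complex. *)
Lemma boundary_modI_regular P y (z : 'cV[R]_N) : upclosed P ->
    (forall m, colon P y m -> P m) -> modI P (koszul *m z) ->
    (exists w, modI (plus P y) (z - koszul *m w)) ->
  exists w, modI P (z - koszul *m w).
Proof.
move=> Pup Py zP [w zw]; have [] := koszul_modI_lift Pup zP zw.
set c := z - _; set v := divmx y c => cv /(modI_sub Py) vP.
exists (w + contract K rho y *m v).
have -> : z - koszul *m (w + contract K rho y *m v) =
   (c - 'X_y *: v) + contract K rho y *m (koszul *m v).
  rewrite mulmxDr opprD addrA -/c -(koszul_homotopy rho_inj).
  by rewrite opprD addrA subrK.
by apply: modID; [exact: cv | exact: modIM].
Qed.

(** Here [d] is the degree of the coefficients, for faces of all sizes at once: the condition is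
    that H_k(x; R/I) vanishes in degree d + k for every k, i.e. along a diagonal of the Betti
    table. *)
Definition vanishes P (d : nat) := forall z : 'cV[R]_N,
  (forall i, in_degree d%:Z (z i 0)) -> modI P (koszul *m z) ->
  exists w, modI P (z - koszul *m w).

Lemma eq_vanishes P P' d : P =1 P' -> vanishes P d -> vanishes P' d.
Proof.
move=> PP' Pd z zd zP; have [|w wP] := Pd z zd.
  by apply: modI_sub zP => m; rewrite PP'.
by exists w; apply: modI_sub wP => m; rewrite PP'.
Qed.

Lemma koszul_degree1 i j : in_degree 1 (koszul i j).
Proof.
rewrite mxE; apply: in_degree_sum => v _.
have Xv : in_degree 1 ('X_v : R).
  by have := in_degreeX K U_(v)%MM; rewrite mdeg1.
by rewrite /ksgn -signr_odd mulr_sign; case: ifP => // _; apply: in_degreeN.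
Qed.

Lemma koszul_consts : consts koszul = 0.
Proof. by apply/consts0P => i j; apply: in_degree_mcoeff0 (koszul_degree1 i j) _. Qed.

(* The long exact sequence of 0 -> R/(I : y)(-1) -> R/I -> R/(I, y) -> 0. *)
Lemma vanishes_split P y d : upclosed P ->
  vanishes (colon P y) d -> vanishes (plus P y) d.+1 -> vanishes P d.+1.
Proof.
move=> Pup Pcolon Pplus z zd zP.
have [|w0 w0P] := Pplus z zd; first by apply: modI_sub zP => m Pm; rewrite /plus Pm.
pose t k (i : 'I_N) : int := k; pose s (i : 'I_1) : int := 0.
(* [w0] need not be homogeneous; since [z] is, the part of [w0] with coefficients of degree d serves
   as well. *)
pose w := hmx (t d) s w0.
have zE : hmx (t d.+1) s z = z.
  by apply: hmx_id => i j; rewrite ord1 subr0; apply: zd.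
have wE : z - koszul *m w = hmx (t d.+1) s (z - koszul *m w0).
  rewrite hmxB zE (hmxMl s w0 (t := t d.+1) (u := t d) (L := koszul)) //.
  by move=> i j; have := koszul_degree1 i j; congr in_degree; rewrite /t; lia.
have wP : modI (plus P y) (z - koszul *m w) by rewrite wE; apply: modI_hmx.
have [] := koszul_modI_lift Pup zP wP.
set c := z - _; set v := divmx y c => cv vP.
have [|u uP] := Pcolon v _ vP.
  move=> i; apply/in_degreeP => m; rewrite mxE mcoeff_mdivX.
  have := hmx_graded (t d.+1) s (z - koszul *m w0); rewrite -wE -/c => /(_ i 0).
  by move/in_degreeP => h /h; rewrite mdegD mdeg1 /t /s; lia.
exists (w + 'X_y *: u).
have -> : z - koszul *m (w + 'X_y *: u) = (c - 'X_y *: v) + 'X_y *: (v - koszul *m u).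
  by rewrite mulmxDr opprD addrA -/c scalerBr -scalemxAr addrA subrK.
by apply: modID => //; apply/modI_var.
Qed.

(** The monomials of the ideal generated by the variables of [A]. *)
Definition hits A : pred 'X_{1..n} := fun m => [exists v in A, (0 < m v)%N].

Lemma hits_up A : upclosed (hits A).
Proof.
move=> m k /exists_inP[v vA m_v]; apply/exists_inP; exists v => //.
by rewrite mnmDE addn_gt0 m_v.
Qed.

Lemma plus_hits A y : plus (hits A) y =1 hits (y |: A).
Proof.
move=> m; rewrite /plus; apply/idP/idP => [/orP[/exists_inP[v vA m_v]|m_y]|].
- by apply/exists_inP; exists v => //; rewrite inE vA orbT.
- by apply/exists_inP; exists y => //; rewrite setU11.
case/exists_inP=> v /setU1P[-> ->|vA m_v]; rewrite ?orbT //.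
by apply/orP; left; apply/exists_inP; exists v.
Qed.

(** Adjoin the remaining variables one at a time, each being regular modulo the previous ones. At
    the end the ideal is (x_1, .., x_n), which contains all coefficients without constant term. *)
Lemma boundary_modI_hits A (z : 'cV[R]_N) :
  (forall i j, (z i j)@_0%MM = 0) -> modI (hits A) (koszul *m z) ->
  exists w, modI (hits A) (z - koszul *m w).
Proof.
move=> z0; have [k] := ubnP #|~: A|; elim: k A => // k IH A Ak zA.
have [AT|] := eqVneq A setT.
  exists 0 => i j m; rewrite mulmx0 subr0 AT => mT.
  rewrite -[RHS](z0 i j); congr (_@__); apply/mnmP => v; rewrite mnm0E.
  by apply/eqP; apply: contraNT mT; rewrite -lt0n => m_v; apply/exists_inP; exists v.
rewrite -subTset => /subsetPn[y _ yA].
apply: (@boundary_modI_regular _ y) => //; first exact: hits_up.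
  move=> m /exists_inP[v vA]; rewrite mnmDE mnm1E => m_v; apply/exists_inP; exists v => //.
  by move: m_v; case: eqP => [yv|]; rewrite ?addn0 //; rewrite yv vA in yA.
have [||w wP] := IH (y |: A).
- rewrite setCU setIC -setDE -ltnS; apply: leq_trans Ak.
  by rewrite ltnS proper_card // properD1 // inE.
- by apply: modI_sub zA => m; rewrite -plus_hits /plus => ->.
by exists w; apply: modI_sub wP => m; rewrite plus_hits.
Qed.

Lemma vanishes_hits A d : vanishes (hits A) d.+1.
Proof.
move=> z zd; apply: boundary_modI_hits => i j.
by rewrite ord1 (in_degree_mcoeff0 (zd i)).
Qed.

Lemma modI_pred0 a b (A : 'M[R]_(a, b)) : modI (hits set0) A -> A = 0.
Proof.
move=> A0; apply/matrixP => i j; apply/mpolyP => m; rewrite mxE mcoeff0 A0 //.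
by apply/exists_inP => -[v]; rewrite inE.
Qed.

(** The coefficient of x_v in the component Q \ v of the boundary is, up to sign, the constant term
    of z(Q). *)
Lemma koszul_cycle_consts r (z : 'M[R]_(N, r)) Q l :
  koszul *m z = 0 -> Q != set0 -> (z (enum_rank Q) l)@_0%MM = 0.
Proof.
move=> z0 /set0Pn[v vQ].
have : (koszul *m z) (enum_rank (Q :\ v)) l = 0 by rewrite z0 mxE.
move/(congr1 (mcoeff U_(v)%MM)); rewrite mcoeff0 koszulE.
rewrite (bigD1 v) ?setD11 //= setD1K // mcoeffD raddf_sum /= big1.
  have UU : (U_(v) - U_(v) = 0 :> 'X_{1..n})%MM by rewrite -{1}[U_(v)%MM]add0m addmK.
  rewrite addr0 /ksgn -signr_odd -mulrA mulr_sign.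
  case: ifP => _; rewrite ?mcoeffN mcoeffMvar mnm1E eqxx /= UU //.
  by move/eqP; rewrite oppr_eq0 => /eqP.
move=> u /andP[_ uv]; by rewrite -mulrA mulrCA mcoeffMvar mnm1E eq_sym (negPf uv).
Qed.

(** By [koszul_cycle_consts] the constant terms outside the empty face vanish automatically, so
    [boundary_modI_hits] for the zero ideal applies to each column. *)
Lemma koszul_exact r (z : 'M[R]_(N, r)) : koszul *m z = 0 ->
  (forall l, (z (enum_rank set0) l)@_0%MM = 0) -> exists w, z = koszul *m w.
Proof.
move=> z0 z_const.
have zc i j : (z i j)@_0%MM = 0.
  rewrite -(enum_valK i); have [->|Q0] := eqVneq (enum_val i) set0; first exact: z_const.
  exact: koszul_cycle_consts.
have /fin_all_exists[w wP] : forall l : 'I_r, exists w : 'cV[R]_N, col l z = koszul *m w.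
  move=> l; have [||w wP] := @boundary_modI_hits set0 (col l z).
  - by move=> i j; rewrite mxE.
  - by rewrite colE mulmxA z0 mul0mx => i j; rewrite mxE; apply: inI0.
  by exists w; apply/eqP; rewrite -subr_eq0; apply/eqP/modI_pred0.
exists (\matrix_(i, l) w l i 0); apply/matrixP => i l.
have -> : z i l = (koszul *m w l) i 0 by rewrite -wP mxE.
by rewrite !mxE; apply: eq_bigr => k _; rewrite !mxE.
Qed.

Definition hdeg k : 'M[R]_N := diag_mx (\row_(i < N) (#|enum_val i| == k)%:R).

Lemma hdegE k r (z : 'M[R]_(N, r)) Q l :
  (hdeg k *m z) (enum_rank Q) l = if #|Q| == k then z (enum_rank Q) l else 0.
Proof.
rewrite /hdeg mul_diag_mx !mxE enum_rankK.
by case: eqP; rewrite ?mul1r ?mul0r.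
Qed.

Lemma koszul_card i j : koszul i j != 0 -> #|enum_val j| = #|enum_val i|.+1.
Proof.
apply: contraNeq => ij; rewrite mxE big1 // => v /andP[vi /eqP jE].
by case/eqP: ij; rewrite jE cardsU1 vi.
Qed.

Lemma hdeg_koszul k : hdeg k *m koszul = koszul *m hdeg k.+1.
Proof.
rewrite /hdeg mul_diag_mx mul_mx_diag; apply/matrixP => i j.
rewrite [LHS]mxE [RHS]mxE [X in X * _ = _]mxE [X in _ = _ * X]mxE mulrC.
have [->|/koszul_card ->] := eqVneq (koszul i j) 0; first by rewrite !mul0r.
by rewrite eqSS.
Qed.

Lemma hdeg_idem k : hdeg k *m hdeg k = hdeg k.
Proof.
apply: chainP => Q l; rewrite hdegE; case: eqP => // /eqP/negPf Qk.
by rewrite !mxE enum_rankK Qk mul0rn.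
Qed.

(** As e_Q has degree #|Q|, these are the coefficient degrees of a chain of internal degree [j]. *)
Definition kshift (j : int) (i : 'I_N) : int := j - #|enum_val i|%:Z.

Lemma koszul_graded j : gradedmx (kshift j) (kshift j) koszul.
Proof.
move=> a b; have [->|ab] := eqVneq (koszul a b) 0; first exact: in_degree0.
have := koszul_degree1 a b; congr in_degree.
by rewrite /kshift (koszul_card ab); lia.
Qed.

Lemma hdeg_graded k j : gradedmx (kshift j) (kshift j) (hdeg k).
Proof.
move=> a b; rewrite !mxE; have [->|ab] := eqVneq a b; last exact: in_degree0.
by rewrite subrr; case: eqP => _; [apply: in_degree1 | apply: in_degree0].
Qed.

Lemma koszul_exact_graded k j r (s : 'I_r -> int) (z : 'M[R]_(N, r)) :
    gradedmx (kshift j) s z -> hdeg k *m z = z -> koszul *m z = 0 ->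
    (forall l, (z (enum_rank set0) l)@_0%MM = 0) ->
  exists w, [/\ gradedmx (kshift j) s w, hdeg k.+1 *m w = w & z = koszul *m w].
Proof.
move=> zs zk z0 /(koszul_exact z0)[w zw]; exists (hdeg k.+1 *m hmx (kshift j) s w); split.
- by apply: gradedmxM (hdeg_graded _ _) (hmx_graded _ _ _).
- by rewrite mulmxA hdeg_idem.
rewrite mulmxA -hdeg_koszul -mulmxA -(hmxMl _ _ (koszul_graded j)) -zw.
by rewrite hmx_id.
Qed.

End MonomialIdeals.

(** * The double complex of the Koszul complex and a minimal free resolution *)

Section Resolution.
Variables (K : fieldType) (n : nat) (rho : 'I_n -> nat).
Hypothesis rho_inj : injective rho.
Local Notation R := {mpoly K[n]}.
Local Notation N := #|{: {set 'I_n}}|.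
Local Notation koszul := (koszul K rho).
Variables (P : pred 'X_{1..n}) (I : R -> Prop).
Hypotheses (P_up : upclosed P) (I_P : forall f, I f <-> inI P f).
Variable F : min_free_resolution I.
Local Notation sh i := (@res_shift _ _ _ F i).

Lemma lift_rows a b c (D : 'M[R]_(b, c)) (A : 'M[R]_(a, c)) :
  (forall i, exists u, row i A = u *m D) -> exists B, A = B *m D.
Proof.
case/fin_all_exists=> u uP; exists (\matrix_i u i).
by apply/row_matrixP => i; rewrite row_mul rowK uP.
Qed.

Lemma res_diff_gradedmx i : gradedmx (sh i.+1) (sh i) (res_diff F i).
Proof. by move=> k l; apply: res_diff_graded. Qed.

Lemma res_aug_gradedmx : gradedmx (sh 0) (fun=> 0) (res_aug F).
Proof. by move=> k l; rewrite ord1 subr0; apply: res_aug_graded. Qed.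

Lemma res_diff_consts i : consts (res_diff F i) = 0.
Proof. by apply/consts0P => k l; apply: res_minimal. Qed.

Lemma res_diff_sq i : res_diff F i.+1 *m res_diff F i = 0.
Proof.
apply/row_matrixP => k; rewrite row_mul row0; apply/res_diff_exact.
by exists (delta_mx 0 k); rewrite -rowE.
Qed.

Lemma res_diff_aug : modI P (res_diff F 0 *m res_aug F).
Proof.
move=> k l; rewrite ord1; have [_ h] := res_aug_exact (row k (res_diff F 0)).
have /I_P := h (ex_intro _ _ (rowE _ _)).
by rewrite -row_mul mxE.
Qed.

Lemma res_diff_lift a i (A : 'M[R]_(a, res_rank F i.+1)) :
  A *m res_diff F i = 0 -> exists B, A = B *m res_diff F i.+1.
Proof.
by move=> A0; apply: lift_rows => k; apply/res_diff_exact; rewrite -row_mul A0 row0.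
Qed.

Lemma res_aug_lift a (A : 'M[R]_(a, res_rank F 0)) :
  modI P (A *m res_aug F) -> exists B, A = B *m res_diff F 0.
Proof.
move=> A0; apply: lift_rows => k; apply/res_aug_exact/I_P.
by rewrite -row_mul mxE.
Qed.

Lemma res_aug_surjmx a (y : 'cV[R]_a) :
  exists B : 'M[R]_(a, res_rank F 0), modI P (y - B *m res_aug F).
Proof.
have /fin_all_exists[u uP] := fun k : 'I_a => res_aug_surj F (y k 0).
exists (\matrix_k u k) => k l; rewrite ord1 !mxE; apply/I_P.
by have := uP k; rewrite !mxE; congr (I (_ - _)); apply: eq_bigr => j _; rewrite mxE.
Qed.

(** The kernel of the composite of the two differentials of the double complex, with R/I in place of
    F_(-1); these are not the cycles of the total complex. [total_boundary] is the sum of the two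
    images, and membership in it is transported along the double complex. *)
Definition total_cycle q : 'M[R]_(N, res_rank F q) -> Prop :=
  match q with
  | 0 => fun z => modI P (koszul *m z *m res_aug F)
  | q'.+1 => fun z => koszul *m z *m res_diff F q' = 0
  end.
Arguments total_cycle : clear implicits.

Lemma total_cycle_koszul q (z : 'M[R]_(N, res_rank F q.+1)) w :
  koszul *m w = z *m res_diff F q -> total_cycle q w.
Proof.
case: q z w => [|q] z w /= ->; rewrite -mulmxA; last by rewrite res_diff_sq mulmx0.
exact: modIM P_up res_diff_aug.
Qed.

Lemma total_cycle0 q (z : 'M[R]_(N, res_rank F q)) :
  koszul *m z = 0 -> total_cycle q z.
Proof.
by case: q z => [|q] z /= ->; rewrite mul0mx // => i j; rewrite mxE; apply: inI0.
Qed.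

Definition total_boundary q (z : 'M[R]_(N, res_rank F q)) : Prop :=
  exists y y', z = koszul *m y + y' *m res_diff F q.

Lemma consts_row0 r (z : 'M[R]_(N, r)) :
  consts z = 0 -> forall l, (z (enum_rank set0) l)@_0%MM = 0.
Proof. by move/consts0P. Qed.

(* A cycle of K (x) F_q is moved along the rows of the double complex K (x) F
   to K (x) F_0, where the vanishing of H(K (x) R/I) applies. *)
Lemma total_boundary_vanishes q : forall k j d (z : 'M[R]_(N, res_rank F q)),
    vanishes K rho P d -> j = d%:Z + k%:Z + q%:Z ->
    gradedmx (kshift j) (sh q) z -> hdeg K n k *m z = z -> total_cycle q z ->
  total_boundary z.
Proof.
elim: q => [|q IH] k j d z Pd jE zj zk zcyc.
  have [||y yP] := Pd (z *m res_aug F).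
  - move=> i; have := gradedmxM zj res_aug_gradedmx i 0.
    rewrite -(enum_valK i) -zk -mulmxA hdegE; case: eqP => [ik|_ _]; last exact: in_degree0.
    by congr in_degree; rewrite /kshift enum_rankK ik; lia.
  - by rewrite mulmxA.
  have [y0 y0P] := res_aug_surjmx y.
  have [|y1 y1P] := res_aug_lift (A := z - koszul *m y0).
    have -> : (z - koszul *m y0) *m res_aug F =
        (z *m res_aug F - koszul *m y) + koszul *m (y - y0 *m res_aug F).
      by rewrite mulmxBl mulmxBr addrA subrK mulmxA.
    by apply: modID; [exact: yP | exact: modIM].
  by exists y0, y1; rewrite -y1P addrC subrK.
(* By minimality the Koszul cycle [z *m res_diff F q] has no constant terms, so it is the boundary
   of some [w] in K_(k+1) (x) F_q, to which the induction hypothesis applies. *)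
have [|||w [wj wk zw]] := koszul_exact_graded rho_inj (gradedmxM zj (@res_diff_gradedmx q))
  (k := k) (z := z *m res_diff F q).
- by rewrite mulmxA zk.
- by rewrite mulmxA.
- by apply: consts_row0; rewrite constsM res_diff_consts mulmx0.
have [||y [y' wE]] := IH k.+1 j d w Pd _ wj wk.
- by rewrite jE; lia.
- exact: total_cycle_koszul (esym zw).
have [|y'' y''P] := res_diff_lift (A := z - koszul *m y').
  rewrite mulmxBl zw wE mulmxDr koszul_sq // add0r mulmxA subrr //.
by exists y', y''; rewrite -y''P addrC subrK.
Qed.

(** The transport in the opposite direction, from K_k (x) F_q down to K_0 (x) F_(k+q). There a
    constant term in internal degree [j] would need a generator of degree [j]; without one,
    [koszul_exact] applies. *)
Lemma total_boundary_degree k : forall q j (z : 'M[R]_(N, res_rank F q)),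
    (forall i (l : 'I_(res_rank F i)), i = (k + q)%N -> sh i l != j) ->
    gradedmx (kshift j) (sh q) z -> hdeg K n k *m z = z -> total_cycle q z ->
  total_boundary z.
Proof.
elim: k => [|k IH] q j z noj zj zk zcyc.
  have [||y zy] := koszul_exact (z := z) rho_inj.
  - apply: chainP => Q l; rewrite koszulE mxE big1 // => v vQ.
    by rewrite -zk hdegE cardsU1 vQ mulr0.
  - move=> l; apply: in_degree_mcoeff0 (zj _ _) _.
    by rewrite /kshift enum_rankK cards0 subr0 subr_eq0 eq_sym noj.
  by exists y, 0; rewrite mul0mx addr0.
have [w zw] : exists w, koszul *m z = w *m res_diff F q.
  case: q {noj zj zk} z zcyc => [|q] z /=; first exact: res_aug_lift.
  exact: res_diff_lift.
pose w' := hdeg K n k *m hmx (kshift j) (sh q.+1) w.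
have zw' : koszul *m z = w' *m res_diff F q.
  rewrite -mulmxA -(hmxMr _ _ (@res_diff_gradedmx q)) -zw hmx_id.
    by rewrite mulmxA hdeg_koszul -mulmxA zk.
  exact: gradedmxM (koszul_graded _ _ _) zj.
have [|||| y [y' w'E]] := IH q.+1 j w'.
- by move=> i l iE; apply: noj; rewrite iE addSnnS.
- exact: gradedmxM (hdeg_graded _ _ _) (hmx_graded _ _ _).
- by rewrite mulmxA hdeg_idem.
- by rewrite /= -mulmxA -zw' koszul_sq.
have [||y2 y2P] := koszul_exact (z := z - y *m res_diff F q) rho_inj.
- rewrite mulmxBr zw' w'E mulmxDl -!mulmxA res_diff_sq mulmx0 addr0 subrr //.
- move=> l; have zl : z (enum_rank set0) l = 0 by rewrite -zk hdegE cards0.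
  have : consts (y *m res_diff F q) = 0 by rewrite constsM res_diff_consts mulmx0.
  by move: (y *m _) => B /consts_row0 B0; rewrite mxE zl add0r mxE mcoeffN B0 oppr0.
by exists y2, y; rewrite -y2P subrK.
Qed.

Lemma betti_neq0 i j : betti F i j != 0%N <-> exists l, sh i l = j.
Proof.
rewrite /betti cards_eq0; split=> [/set0Pn[l]|[l lj]].
  by rewrite inE => /eqP; exists l.
by apply/set0Pn; exists l; rewrite inE lj.
Qed.

(** A generator of degree j of F_i with j - i > a, placed on the empty face, is killed by the Koszul
    differential. Transport makes it a sum of images of the two differentials, which have no
    constant terms, yet it has an entry 1. *)
Lemma betti_le_vanishes a : (forall d, (a < d)%N -> vanishes K rho P d) ->
  forall i j, betti F i j != 0%N -> j - i%:Z <= a%:Z.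
Proof.
move=> Pa i j /betti_neq0[l lj]; rewrite leNgt; apply/negP => ij.
have [d dE] : exists d : nat, j = d%:Z + 0%:Z + i%:Z by exists `|j - i%:Z|%N; lia.
pose z : 'M[R]_(N, res_rank F i) := \matrix_(Q, k) ((Q == enum_rank set0) && (k == l))%:R.
have koszul_z : koszul *m z = 0.
  apply: chainP => Q k; rewrite koszulE mxE big1 // => v vQ.
  rewrite mxE (inj_eq enum_rank_inj) (_ : _ == set0 = false) ?mulr0 //.
  by apply/negbTE/set0Pn; exists v; rewrite setU11.
have [|||||y [y' zE]] := @total_boundary_vanishes i 0 j d z.
- by apply: Pa; lia.
- exact: dE.
- move=> Q k; rewrite mxE; case: andP => [[/eqP-> /eqP->]|_]; last exact: in_degree0.
  by rewrite /kshift enum_rankK cards0 lj subr0 subrr; apply: in_degree1.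
- apply: chainP => Q k; rewrite hdegE cards_eq0; case: eqP => // /eqP Q0.
  by rewrite mxE (inj_eq enum_rank_inj) (negPf Q0).
- exact: total_cycle0.
have := congr1 (@consts K n _ _) zE.
rewrite constsD !constsM res_diff_consts koszul_consts mul0mx mulmx0 addr0.
by move/consts0P/(_ (enum_rank set0) l)/eqP; rewrite mxE !eqxx mcoeff1 eqxx oner_eq0.
Qed.

(** Lift the class to a chain [z0] over F_0. If F_k had no generator of degree d + k,
    [total_boundary_degree] would split [z0] into images, and applying [res_aug] would make [z] a
    boundary modulo I. *)
Lemma betti_neq0_cycle k d (z : 'cV[R]_N) :
    (forall i, in_degree d%:Z (z i 0)) -> hdeg K n k *m z = z ->
    modI P (koszul *m z) -> ~ (exists w, modI P (z - koszul *m w)) ->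
  betti F k (d%:Z + k%:Z) != 0%N.
Proof.
move=> zd zk zP zNb; apply/negP => Fkd; case: zNb.
have noj i (l : 'I_(res_rank F i)) : i = (k + 0)%N -> sh i l != (d%:Z + k%:Z).
  rewrite addn0 => ik; apply: contraTneq Fkd => lj.
  by rewrite ik in l lj *; apply/betti_neq0; exists l.
have [B BP] := res_aug_surjmx z.
pose j := d%:Z + k%:Z; pose z0 := hdeg K n k *m hmx (kshift j) (sh 0) B.
have z0P : modI P (z - z0 *m res_aug F).
  have -> : z - z0 *m res_aug F = hdeg K n k *m hmx (kshift j) (fun=> 0) (z - B *m res_aug F).
    rewrite hmxB (hmxMr _ _ res_aug_gradedmx) mulmxBr mulmxA hmx_id ?zk //.
    move=> i l; rewrite ord1 subr0 -(enum_valK i) -zk hdegE.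
    case: eqP => [ik|_]; last exact: in_degree0.
    by have := zd (enum_rank (enum_val i)); congr in_degree; rewrite /j /kshift enum_rankK ik; lia.
  by apply: modIM => //; apply: modI_hmx.
have [||| y [y' z0E]] := total_boundary_degree noj (z := z0).
- exact: gradedmxM (hdeg_graded _ _ _) (hmx_graded _ _ _).
- by rewrite mulmxA hdeg_idem.
- rewrite /= -mulmxA (_ : _ *m _ = koszul *m z - koszul *m (z - z0 *m res_aug F)).
    by apply: modIB => //; apply: modIM.
  by rewrite mulmxBr opprB addrC subrK.
exists (y *m res_aug F).
have -> : z - koszul *m (y *m res_aug F) =
    (z - z0 *m res_aug F) + y' *m (res_diff F 0 *m res_aug F).
  by rewrite z0E mulmxDl opprD !mulmxA addrA subrK.
by apply: modID => //; apply: modIM res_diff_aug.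
Qed.

End Resolution.

(** * Existence of graded minimal free resolutions *)

Section Existence.
Variables (K : fieldType) (n : nat).
Local Notation R := {mpoly K[n]}.

Definition submodule r (M : 'rV[R]_r -> Prop) :=
  [/\ M 0, forall u v, M u -> M v -> M (u + v) & forall a u, M u -> M (a *: u)].

Lemma submodule_sum r (M : 'rV[R]_r -> Prop) (T : Type) (q : seq T) (p : pred T) f :
  submodule M -> (forall i, p i -> M (f i)) -> M (\sum_(i <- q | p i) f i).
Proof. by case=> M0 MD _ Mf; apply: big_ind. Qed.

Lemma submodule_sum_seq r (M : 'rV[R]_r -> Prop) (T : eqType) (q : seq T) f :
  submodule M -> (forall i, i \in q -> M (f i)) -> M (\sum_(i <- q) f i).
Proof. by move=> Msub Mf; rewrite big_seq; apply: submodule_sum. Qed.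

Definition rowspan a r (G : 'M[R]_(a, r)) (v : 'rV[R]_r) :=
  exists u, v = u *m G.

Lemma rowspan_submodule a r (G : 'M[R]_(a, r)) : submodule (rowspan G).
Proof.
split=> [|u v [u' ->] [v' ->]|c u [u' ->]].
- by exists 0; rewrite mul0mx.
- by exists (u' + v'); rewrite mulmxDl.
- by exists (c *: u'); rewrite scalemxAl.
Qed.

Lemma rowspan_row a r (G : 'M[R]_(a, r)) i : rowspan G (row i G).
Proof. by exists (delta_mx 0 i); rewrite -rowE. Qed.

Lemma rowspan_sub a r (G : 'M[R]_(a, r)) M : submodule M ->
  (forall i, M (row i G)) -> forall v, rowspan G v -> M v.
Proof.
move=> Msub MG v [u ->]; rewrite mulmx_sum_row; apply: submodule_sum => // i _.
by case: Msub => _ _; apply.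
Qed.

(** Induction on the number [k] of coordinates compared. If [B] works for the first [k] and [c] is
    the largest next coordinate in [B], then [B] handles the elements whose next coordinate is at
    least [c]; the finitely many slices below [c] are handled one by one. [X] is arbitrary so that
    vectors can be compared through their leading monomials. *)
Lemma dickson (X : eqType) (co : 'I_n -> X -> nat) (S : X -> Prop) :
  exists B : seq X, (forall b, b \in B -> S b) /\
    forall m, S m -> exists2 b, b \in B & forall i, (co i b <= co i m)%N.
Proof.
suff main k : exists B : seq X, (forall b, b \in B -> S b) /\
    forall m, S m -> exists2 b, b \in B & forall i : 'I_n, (i < k)%N -> (co i b <= co i m)%N.
  have [B [BS SB]] := main n.
  by exists B; split=> // m /SB[b bB bm]; exists b => // i; apply: bm.
elim: k S => [|k IH] S.
  have [[b Sb]|Sempty] := classic (exists b, S b).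
    by exists [:: b]; split=> [c|m _]; [rewrite inE => /eqP-> | exists b; rewrite ?inE].
  by exists [::]; split=> // m Sm; case: Sempty; exists m.
have [nk|kn] := leqP n k.
  have [B [BS SB]] := IH S; exists B; split=> // m /SB[b bB bm]; exists b => // i _.
  by apply: bm; apply: leq_trans nk.
pose i0 := Ordinal kn; have [B [BS SB]] := IH S.
pose c := \max_(b <- B) co i0 b.
suff [B' [B'S SB']] : exists B' : seq X, (forall b, b \in B' -> S b) /\
    forall m, S m -> (co i0 m < c)%N ->
      exists2 b, b \in B' & forall i : 'I_n, (i < k.+1)%N -> (co i b <= co i m)%N.
  exists (B ++ B'); split=> [b|m Sm]; first by rewrite mem_cat => /orP[/BS|/B'S].
  have [mc|cm] := ltnP (co i0 m) c.
    by have [b bB' bm] := SB' m Sm mc; exists b; rewrite // mem_cat bB' orbT.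
  have [b bB bm] := SB m Sm; exists b; first by rewrite mem_cat bB.
  move=> i; rewrite ltnS leq_eqVlt => /orP[/eqP ik|]; last exact: bm.
  rewrite (_ : i = i0); last exact: val_inj.
  by apply: leq_trans cm; rewrite /c; apply: (@leq_bigmax_seq _ _ xpredT (co i0)).
elim: {SB BS B} c => [|c [B' [B'S SB']]]; first by exists [::].
have [B [BS SB]] := IH (fun m => S m /\ co i0 m = c).
exists (B ++ B'); split=> [b|m Sm]; first by rewrite mem_cat => /orP[/BS[]|/B'S].
rewrite ltnS leq_eqVlt => /orP[/eqP mc|mc]; last first.
  by have [b bB' bm] := SB' m Sm mc; exists b; rewrite // mem_cat bB' orbT.
have [b bB bm] := SB m (conj Sm mc); exists b; first by rewrite mem_cat bB.
move=> i; rewrite ltnS leq_eqVlt => /orP[/eqP ik|]; last exact: bm.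
by rewrite (_ : i = i0) ?mc; [have [_ ->] := BS b bB | apply: val_inj].
Qed.

Lemma lead_reduce (p q : R) : p != 0 -> q != 0 -> (mlead q <= mlead p)%MM ->
  exists a, p - a * q = 0 \/ (mlead (p - a * q)%R < mlead p)%O.
Proof.
move=> p0 q0 qp; pose a : R := (mleadc p / mleadc q) *: 'X_[mlead p - mlead q].
exists a; have [->|paq0] := eqVneq (p - a * q) 0; [by left | right].
have aq_c : (a * q)@_(mlead p) = mleadc p.
  have := mcoeffMX q (mlead p - mlead q)%MM (mlead q); rewrite submK // => XqE.
  by rewrite /a -scalerAl mcoeffZ ['X_[_] * q]mulrC XqE divfK // mleadc_eq0.
rewrite lt_neqAle; apply/andP; split.
  apply: contra_neq paq0 => eq_lead; apply/eqP; rewrite -mleadc_eq0 eq_lead.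
  by rewrite mcoeffB aq_c subrr.
apply: le_trans (mleadB_le _ _) _; rewrite leUx lexx /=.
apply: le_trans (mleadM_le _ _) _; apply: le_trans (_ : (mlead p - mlead q + mlead q <= _)%O)%MM.
  by rewrite lemc_add2l; apply: le_trans (mleadZ_le _ _) _; rewrite mleadXm.
by rewrite submK.
Qed.

(** [S l] collects the vectors of M whose first nonzero entry is at [l]; Dickson's lemma gives
    finitely many whose leading monomials there divide those of all others. Division terminates by
    induction on the number of positions left, then on the leading monomial. *)
Lemma noetherian r (M : 'rV[R]_r -> Prop) : submodule M ->
  exists B : seq 'rV[R]_r, (forall b, b \in B -> M b) /\
    forall M', submodule M' -> (forall b, b \in B -> M' b) -> forall v, M v -> M' v.
Proof.
move=> [M0 MD MZ].
pose S (l : 'I_r) v := [/\ M v, forall i : 'I_r, (i < l)%N -> v 0 i = 0 & v 0 l != 0].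
have /fin_all_exists[B BP] := fun l => dickson (fun i (v : 'rV[R]_r) => mlead (v 0 l) i) (S l).
exists (flatten [seq B l | l <- enum 'I_r]); split=> [b /flattenP[_ /mapP[l _ ->]] bB|].
  by have [/(_ b bB)[]] := BP l.
move=> M' [M'0 M'D M'Z] BM' v Mv.
have {}BM' l b : b \in B l -> M' b.
  move=> bB; apply: BM'; apply/flattenP; exists (B l) => //.
  by apply/mapP; exists l; rewrite ?mem_enum.
suff main k : forall v, M v -> (forall i : 'I_r, (i < r - k)%N -> v 0 i = 0) -> M' v.
  by apply: (main r) => // i; rewrite subnn.
elim: k => [|k IH] {}v {}Mv v0.
  rewrite (_ : v = 0) //; apply/rowP => i; rewrite mxE v0 // subn0; exact: ltn_ord.
have [rk|kr] := leqP r k.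
  by apply: IH => // i; rewrite (_ : _ - _ = 0)%N //; apply/eqP; rewrite subn_eq0.
have lr : (r - k.+1 < r)%N by lia.
pose l := Ordinal lr.
have IH' w : M w -> (forall i : 'I_r, (i < l)%N -> w 0 i = 0) -> w 0 l = 0 -> M' w.
  move=> Mw w0 wl; apply: IH => // i ik.
  have [il|li] := ltnP i l; first exact: w0.
  by rewrite (_ : i = l) //; apply: val_inj => /=; move: li ik => /=; lia.
move mE : (mlead (v 0 l)) => m.
elim/(well_founded_ind (@ltom_wf n)): m v Mv v0 mE => m IHm v Mv v0 mE.
have [vl|vl] := eqVneq (v 0 l) 0; first exact: IH'.
have [_ /(_ v)[//|b bB /mnm_lepP bv]] := BP l.
have [Mb b0 bl] := (BP l).1 b bB.
have [a ab] := lead_reduce vl bl bv.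
rewrite -[v](subrK (a *: b)); apply: M'D; last by apply/M'Z/(BM' l).
have Mw : M (v - a *: b) by rewrite -scaleNr; apply: MD => //; apply: MZ.
have w0 (i : 'I_r) : (i < l)%N -> (v - a *: b) 0 i = 0.
  by move=> il; rewrite !mxE v0 // b0 // mulr0 subrr.
have wl : (v - a *: b) 0 l = v 0 l - a * b 0 l by rewrite !mxE.
case: ab => ab; first by apply: IH' => //; rewrite wl.
by apply: (IHm (mlead (v 0 l - a * b 0 l))); rewrite -?mE // wl.
Qed.

Definition hrow r (s : 'I_r -> int) z (v : 'rV[R]_r) := hmx (fun=> z) s v.

Definition row_degrees r (s : 'I_r -> int) (v : 'rV[R]_r) : seq int :=
  undup [seq (mdeg m)%:Z + s l | l <- enum 'I_r, m <- msupp (v 0 l)].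

Lemma sum_hrow r (s : 'I_r -> int) v : v = \sum_(z <- row_degrees s v) hrow s z v.
Proof.
apply/rowP => l; apply/mpolyP => m; rewrite summxE raddf_sum /=.
under eq_bigr do rewrite mxE mcoeff_hpart.
have [m_v|m_v] := boolP (m \in msupp (v 0 l)); last first.
  by rewrite (memN_msupp_eq0 m_v) big1 // => z _; rewrite if_same.
rewrite (bigD1_seq ((mdeg m)%:Z + s l)) ?undup_uniq /= ?addrK ?eqxx ?big1 ?addr0 //.
  by move=> z zm; rewrite ifN //; apply: contra zm => /eqP ->; rewrite subrK.
rewrite mem_undup; apply/allpairsPdep; exists l, m; split=> //; exact: mem_enum.
Qed.

Definition graded_submodule r (s : 'I_r -> int) (M : 'rV[R]_r -> Prop) :=
  submodule M /\ forall z v, M v -> M (hrow s z v).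

Lemma graded_generators r (s : 'I_r -> int) M : graded_submodule s M ->
  exists a (t : 'I_a -> int) (G : 'M[R]_(a, r)),
    gradedmx t s G /\ forall v, M v <-> rowspan G v.
Proof.
case=> Msub Mgr; have [B [BM MB]] := noetherian Msub.
pose L := [seq (z, hrow s z b) | b <- B, z <- row_degrees s b].
have LP i : (i < size L)%N -> exists z b, b \in B /\ nth (0, 0) L i = (z, hrow s z b).
  move/(mem_nth (0, 0)) => /allpairsPdep[b [z [bB _ ->]]]; by exists z, b.
pose G := \matrix_(i < size L) (nth (0, 0) L i).2.
exists (size L), (fun i => (nth (0, 0) L i).1), G; split.
  move=> i j; rewrite mxE; have [z [b [_ ->]]] := LP i (ltn_ord i).
  exact: (hmx_graded (fun=> z) s b 0 j).
move=> v; split; last first.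
  apply: rowspan_sub => // i; rewrite rowK; have [z [b [bB ->]]] := LP i (ltn_ord i).
  exact/Mgr/BM.
apply: MB v => [|b bB]; first exact: rowspan_submodule.
rewrite (sum_hrow s b); apply: submodule_sum_seq => [|z zb]; first exact: rowspan_submodule.
have zL : (z, hrow s z b) \in L by apply/allpairsPdep; exists b, z.
have iL : (index (z, hrow s z b) L < size L)%N by rewrite index_mem.
rewrite (_ : hrow s z b = row (Ordinal iL) G); first exact: rowspan_row.
by rewrite rowK nth_index.
Qed.

(** Graded Nakayama: a relation with a nonzero constant coefficient makes one generator redundant,
    so generators are removed until there is none. *)
Lemma minimal_generators r (s : 'I_r -> int) M : submodule M ->
  forall a (t : 'I_a -> int) (G : 'M[R]_(a, r)),
    gradedmx t s G -> (forall v, M v <-> rowspan G v) ->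
  exists a' (t' : 'I_a' -> int) (G' : 'M[R]_(a', r)),
    [/\ gradedmx t' s G', forall v, M v <-> rowspan G' v
      & forall u : 'rV[R]_a', u *m G' = 0 -> consts u = 0].
Proof.
move=> Msub; elim=> [|a IH] t G Gts MG.
  by exists 0%N, t, G; split=> // u _; apply/rowP => -[].
have [Gmin|] := classic (forall u : 'rV[R]_a.+1, u *m G = 0 -> consts u = 0).
  by exists a.+1, t, G.
move=> Gmin; have [u hu] := not_all_ex_not _ _ Gmin; have [uG uc] := imply_to_and _ _ hu.
have [k uk] : exists k, (u 0 k)@_0%MM != 0.
  apply: NNPP => h; case: uc; apply/consts0P => i k.
  by rewrite ord1; apply/eqP/negbNE/negP => uk; apply: h; exists k.
(* In this homogeneous part of the relation, entry [k] has degree 0, so it is the nonzero constant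
   of [u 0 k], a unit. *)
pose h := hrow t (t k) u.
have hG : h *m G = 0.
  by rewrite -(hmxMr _ _ Gts) uG; apply/matrixP => i j; rewrite !mxE raddf0.
have hk : h 0 k = ((u 0 k)@_0%MM)%:MP.
  apply/mpolyP => m; rewrite mxE subrr mcoeff_hpart mcoeffC eqz_nat mdeg_eq0.
  by case: eqP => [->|]; rewrite ?mulr1 ?mulr0.
have sub' := rowspan_submodule (row' k G).
have row_lift j : rowspan (row' k G) (row (lift k j) G).
  rewrite (_ : row _ G = row j (row' k G)); first exact: rowspan_row.
  by apply/rowP => x; rewrite !mxE.
have row'G i : rowspan (row' k G) (row i G).
  have [j ->|->] := unliftP k i; first exact: row_lift.
  move: hG; rewrite mulmx_sum_row (bigD1 k) //= hk => /eqP; rewrite addr_eq0 => /eqP hG.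
  have -> : row k G = ((u 0 k)@_0%MM)^-1%:MP *: (((u 0 k)@_0%MM)%:MP *: row k G).
    by rewrite scalerA -mpolyCM mulVf // mpolyC1 scale1r.
  have [_ _ subZ] := sub'; apply: (subZ); rewrite hG -scaleN1r; apply: (subZ).
  apply: submodule_sum => // l lk; apply: (subZ).
  by have [j ->|lk'] := unliftP k l; [exact: row_lift | rewrite lk' eqxx in lk].
have G'gr : gradedmx (fun i => t (lift k i)) s (row' k G) by move=> i j; rewrite mxE.
apply: (IH _ _ G'gr) => v.
split=> [/MG|]; first exact: rowspan_sub.
apply: rowspan_sub => // i; apply/MG.
rewrite (_ : row i _ = row (lift k i) G); first exact: rowspan_row.
by apply/rowP => x; rewrite !mxE.
Qed.

(** A graded submodule of a free module, to be covered next. Minimality of a cover gives [st_consts]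
    for its kernel, so that the next differential has no constant terms either. *)
Record stage := Stage {
  st_rank : nat;
  st_shift : 'I_st_rank -> int;
  st_sub : 'rV[R]_st_rank -> Prop;
  st_graded : graded_submodule st_shift st_sub;
  st_consts : forall v, st_sub v -> consts v = 0
}.

Definition cover_spec (S : stage) (C : {a & ('I_a -> int) * 'M[R]_(a, st_rank S)}%type) :=
  [/\ gradedmx (projT2 C).1 (@st_shift S) (projT2 C).2,
      forall v, st_sub v <-> rowspan (projT2 C).2 v
    & forall u : 'rV[R]_(projT1 C), u *m (projT2 C).2 = 0 -> consts u = 0].

Lemma cover_exists S : exists C, @cover_spec S C.
Proof.
have [a0 [t0 [G0 [G0gr G0span]]]] := graded_generators (st_graded S).
have [a [t [G [Ggr Gspan Gmin]]]] := minimal_generators (st_graded S).1 G0gr G0span.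
by exists (existT _ a (t, G)).
Qed.

Definition cover S := proj1_sig (constructive_indefinite_description _ (cover_exists S)).
Definition cover_rank S := projT1 (cover S).
Definition cover_shift S : 'I_(cover_rank S) -> int := (projT2 (cover S)).1.
Definition cover_mx S : 'M[R]_(cover_rank S, st_rank S) := (projT2 (cover S)).2.

Lemma coverP S : [/\ gradedmx (@cover_shift S) (@st_shift S) (cover_mx S),
  forall v, st_sub v <-> rowspan (cover_mx S) v
  & forall u : 'rV[R]_(cover_rank S), u *m cover_mx S = 0 -> consts u = 0].
Proof. exact: proj2_sig (constructive_indefinite_description _ (cover_exists S)). Qed.

Lemma cover_kernel_graded S :
  graded_submodule (@cover_shift S) (fun u : 'rV[R]_(cover_rank S) => u *m cover_mx S = 0).
Proof.
have [Ggr _ _] := coverP S; split; first split.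
- by rewrite mul0mx.
- by move=> u v uG vG; rewrite mulmxDl uG vG addr0.
- by move=> a u uG; rewrite -scalemxAl uG scaler0.
move=> z v vG; rewrite -(hmxMr _ _ Ggr) vG.
by apply/matrixP => i j; rewrite !mxE raddf0.
Qed.

Lemma cover_kernel_consts S (u : 'rV[R]_(cover_rank S)) : u *m cover_mx S = 0 -> consts u = 0.
Proof. by have [_ _] := coverP S; apply. Qed.

Definition next_stage S : stage :=
  Stage (cover_kernel_graded S) (@cover_kernel_consts S).

Variables (P : pred 'X_{1..n}) (I : R -> Prop).
Hypotheses (P_up : upclosed P) (I_P : forall f, I f <-> inI P f) (P0 : ~~ P 0%MM).

Lemma first_stage_graded :
  graded_submodule (fun=> 0) (fun v : 'rV[R]_1 => I (v 0 0)).
Proof.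
split; first split.
- by rewrite mxE; apply/I_P; apply: inI0.
- by move=> u v /I_P uI /I_P vI; rewrite mxE; apply/I_P; apply: inID.
- by move=> a u /I_P uI; rewrite mxE; apply/I_P; apply: inIM.
by move=> z v /I_P vI; apply/I_P => m Pm; rewrite mxE mcoeff_hpart vI ?if_same.
Qed.

Lemma first_stage_consts (v : 'rV[R]_1) : I (v 0 0) -> consts v = 0.
Proof. by move/I_P => vI; apply/consts0P => i j; rewrite !ord1 vI. Qed.

Definition stages i := iter i next_stage (Stage first_stage_graded first_stage_consts).

Lemma min_free_resolution_exists : inhabited (min_free_resolution I).
Proof.
constructor; apply: (@MinFreeResolution K n I (fun i => st_rank (stages i))
  (fun i => @st_shift (stages i)) (fun i => cover_mx (stages i)) (1%:M : 'M[R]_1)).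
- by move=> k; rewrite ord1 mxE eqxx /=; apply: in_degree1.
- by move=> i; have [Ggr _ _] := coverP (stages i).
- by move=> f; exists f%:M; rewrite mulmx1 mxE eqxx subrr; apply/I_P; apply: inI0.
- by move=> v; rewrite mulmx1; have [_ Gspan _] := coverP (stages 0); apply: (Gspan v).
- by move=> i v; have [_ Gspan _] := coverP (stages i.+1); apply: (Gspan v).
move=> i k l; have [_ Gspan _] := coverP (stages i).
have /st_consts/consts0P/(_ 0 l) := (Gspan _).2 (rowspan_row (cover_mx (stages i)) k).
by rewrite mxE.
Qed.

End Existence.

(** * Forests: leaves, parent functions and matched vertex covers *)

Section Forest.
Variables (T : finType) (e : rel T).
Hypotheses (e_sym : ssrbool.symmetric e) (e_irr : irreflexive e) (e_forest : is_forest e).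
Implicit Types (u v w : T) (U C : {set T}).

(** Otherwise a path in U can always be extended without turning back. A repeated vertex would close
    a cycle, of length at least 3 as the step does not turn back, so there would be simple paths of
    every length. *)
Lemma forest_leaf U : U != set0 ->
  exists2 u, u \in U & forall v w, v \in U -> w \in U -> e u v -> e u w -> v = w.
Proof.
move=> /set0Pn[u0 u0U]; apply: NNPP => noleaf.
have nbr u x : u \in U -> exists v, [/\ v \in U, e u v & v != x].
  move=> uU; apply: NNPP => no_v; apply: noleaf; exists u => // v w vU wU uv uw.
  have [vx|vx] := eqVneq v x; last by case: no_v; exists v.
  have [wx|wx] := eqVneq w x; last by case: no_v; exists w.
  by rewrite vx wx.
suff /(_ #|T|)[x [p [_ _ /card_uniqP xp p_size]]] k : exists x p,
    [/\ x \in U, path e x p, uniq (x :: p) & size p = k].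
  by have := max_card (mem (x :: p)); rewrite xp /= p_size ltnn.
elim: k => [|k [x [p [xU xp xp_uniq p_size]]]]; first by exists u0, [::].
have [v [vU xv v_head]] := nbr x (head x p) xU.
exists v, (x :: p); split=> //=; [by rewrite e_sym xv | | by rewrite p_size].
rewrite inE negb_or -/(uniq (x :: p)) xp_uniq andbT; apply/andP; split.
  by apply: contraTneq xv => ->; rewrite e_irr.
apply/negP => vp; case/splitPr: vp xp xp_uniq v_head {p_size} => p1 p2 xp xp_uniq v_head.
move: xp; rewrite cat_path => /andP[xp1 /andP[p1v _]].
move: xp_uniq; rewrite -cat_rcons -cat_cons cat_uniq => /andP[c_uniq _].
apply: (e_forest (c := x :: rcons p1 v)).
  by case: p1 v_head {xp1 p1v c_uniq} => [|y p1]; rewrite ?eqxx //= size_rcons.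
by rewrite /ucycle /= !rcons_path xp1 p1v last_rcons e_sym xv.
Qed.

(** Remove a leaf of U and make its only possible neighbor in U its parent; induction handles the
    other edges. *)
Lemma forest_parent : exists par : T -> option T,
  forall u v, e u v -> par u = Some v \/ par v = Some u.
Proof.
suff /(_ setT)[par parP] U : exists par : T -> option T, forall u v, u \in U -> v \in U ->
    e u v -> par u = Some v \/ par v = Some u.
  by exists par => u v; apply: parP.
have [k] := ubnP #|U|; elim: k U => // k IH U Uk.
have [->|U0] := eqVneq U set0; first by exists (fun=> None) => u v; rewrite inE.
have [x xU x_leaf] := forest_leaf U0.
have [|par parP] := IH (U :\ x); first by rewrite (cardsD1 x) xU in Uk.
exists (fun u => if u == x then [pick v in U | e x v] else par u) => u v uU vU uv.
have pick_x w : w \in U -> e x w -> [pick v in U | e x v] = Some w.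
  move=> wU xw; case: pickP => [w' /andP[w'U xw']|/(_ w)]; last by rewrite wU xw.
  by rewrite (x_leaf w w').
have [ux|ux] := eqVneq u x; first by left; rewrite (pick_x v) // -ux.
have [vx|vx] := eqVneq v x; first by right; rewrite (pick_x u) // -vx e_sym.
by apply: parP; rewrite // !inE ?ux ?vx.
Qed.

(* Such a pair certifies Konig's theorem: [mate] matches each vertex of the
   vertex cover [C] with a vertex outside [C] and fixes the other vertices. *)
Record matched_cover U C (mate : T -> T) : Prop := MatchedCover {
  cover_sub : C \subset U;
  mate_inv : involutive mate;
  mate_out : forall v, v \notin U -> mate v = v;
  mate_edge : forall v, mate v != v -> e v (mate v);
  mate_cover : forall v, mate v != v -> (mate v \in C) = (v \notin C);
  cover_mate : forall v, v \in C -> mate v != v;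
  cover_edge : forall u v, u \in U -> v \in U -> e u v -> (u \in C) || (v \in C)
}.

(** If the leaf [x] has a neighbor [y] in U, put [y] into the cover, match it with [x] and remove
    both: [y] covers every edge of U at [x] or [y]. An isolated [x] is just removed. *)
Lemma forest_matched_cover : exists C mate, matched_cover setT C mate.
Proof.
move: setT => U; have [k] := ubnP #|U|; elim: k U => // k IH U Uk.
have [->|U0] := eqVneq U set0.
  exists set0, id; split=> // [v|v|v|u v]; rewrite ?eqxx ?inE //.
have [x xU x_leaf] := forest_leaf U0.
have [/existsP[y /andP[yU xy]]|no_y] := boolP [exists y, (y \in U) && e x y]; last first.
  have [|C [mate [Csub invm outm edgem coverm matec coverC]]] := IH (U :\ x).
    by rewrite (cardsD1 x) xU in Uk.
  have no_x v : v \in U -> e x v = false.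
    by move=> vU; apply: contraNF no_y => xv; apply/existsP; exists v; rewrite vU.
  exists C, mate; split=> //.
  - exact: subset_trans Csub (subD1set _ _).
  - by move=> v vU; apply: outm; rewrite !inE negb_and vU orbT.
  move=> u v uU vU uv; apply: coverC => //; rewrite !inE ?uU ?vU andbT.
    by apply: contraTneq uv => ->; rewrite no_x.
  by apply: contraTneq uv => ->; rewrite e_sym no_x.
have xNy : x != y by apply: contraTneq xy => ->; rewrite e_irr.
have [|C [mate [Csub invm outm edgem coverm matec coverC]]] := IH (U :\ x :\ y).
  rewrite (cardsD1 x) xU ltnS in Uk; apply: leq_trans Uk.
  by rewrite ltnS subset_leq_card ?subD1set.
have xC : x \notin C by apply: contra (subsetP Csub x) _; rewrite !inE eqxx andbF.
have yC : y \notin C by apply: contra (subsetP Csub y) _; rewrite !inE eqxx.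
have mx : mate x = x by apply: outm; rewrite !inE eqxx andbF.
have my : mate y = y by apply: outm; rewrite !inE eqxx.
pose mate' v := if v == x then y else if v == y then x else mate v.
have mate'x : mate' x = y by rewrite /mate' eqxx.
have mate'y : mate' y = x by rewrite /mate' eq_sym (negPf xNy) eqxx.
have mate'E v : v != x -> v != y -> mate' v = mate v.
  by rewrite /mate' => /negPf-> /negPf->.
have mate_x v : v != x -> mate v != x by apply: contra_neq => vx; rewrite -[v]invm vx.
have mate_y v : v != y -> mate v != y by apply: contra_neq => vy; rewrite -[v]invm vy.
exists (y |: C), mate'; split.
- rewrite subUset sub1set yU; apply: subset_trans Csub _.
  exact: subset_trans (subD1set _ _) (subD1set _ _).
- move=> v; have [->|vx] := eqVneq v x; first by rewrite mate'x.
  have [->|vy] := eqVneq v y; first by rewrite mate'y.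
  by rewrite (mate'E v) // mate'E ?mate_x ?mate_y.
- move=> v vU; have vx : v != x by apply: contraNneq vU => ->.
  have vy : v != y by apply: contraNneq vU => ->.
  by rewrite mate'E //; apply: outm; rewrite !inE (negPf vU) !andbF.
- move=> v; have [->|vx] := eqVneq v x; first by rewrite mate'x.
  have [->|vy] := eqVneq v y; first by rewrite mate'y e_sym.
  by rewrite mate'E //; apply: edgem.
- move=> v; have [->|vx] := eqVneq v x; first by rewrite mate'x !inE eqxx negb_or xNy xC.
  have [->|vy] := eqVneq v y; first by rewrite mate'y !inE eqxx (negPf xNy) (negPf xC).
  by rewrite mate'E // !inE (negPf vy) (negPf (mate_y _ vy)); apply: coverm.
- move=> v /setU1P[->|vC]; first by rewrite mate'y.
  have vx : v != x by apply: contraNneq xC => <-.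
  have vy : v != y by apply: contraNneq yC => <-.
  by rewrite mate'E // matec.
move=> u v uU vU uv; rewrite !inE.
have [//|uy] := eqVneq u y; have [|vy] := eqVneq v y; first by rewrite orbT.
have ux : u != x.
  by apply: contraNneq vy => ux; apply/eqP/x_leaf => //; rewrite -ux.
have vx : v != x.
  by apply: contraNneq uy => vx; apply/eqP/x_leaf => //; rewrite -vx e_sym.
by apply: coverC; rewrite // !inE ?uU ?vU ?ux ?uy ?vx ?vy.
Qed.

(** Disjoint edges contain distinct vertices of the cover, which bounds every matching; the edges
    from [c] in C to [mate c] attain the bound and are disjoint because mates are distinct and lie
    outside C. *)
Lemma matching_number_cover C mate :
  matched_cover setT C mate -> matching_number e = #|C|.
Proof.
case=> _ invm _ edgem coverm matec coverC; apply/eqP; rewrite eqn_leq; apply/andP; split.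
  apply/bigmax_leqP => M /andP[/subsetP Medges Mtriv].
  pose g (A : {set T}) := [pick c in A :&: C].
  have gP A : A \in M -> exists2 c, c \in A :&: C & g A = Some c.
    move=> /Medges /imsetP[[u v]]; rewrite inE /= => uv AE.
    rewrite /g; case: pickP => [c cAC|noc]; first by exists c.
    have /orP[uC|vC] := coverC u v (in_setT _) (in_setT _) uv.
      by have := noc u; rewrite AE !inE eqxx uC.
    by have := noc v; rewrite AE !inE eqxx vC orbT.
  rewrite -(card_in_imset (f := g) (D := M)).
    have Some_inj : injective (@Some T) by move=> ? ? [].
    rewrite -(card_imset (mem C) Some_inj); apply/subset_leq_card/subsetP => _ /imsetP[A AM ->].
    by have [c /setIP[_ cC] ->] := gP A AM; apply: imset_f.
  move=> A B AM BM; have [c /setIP[cA _] ->] := gP A AM; have [d /setIP[dB _] ->] := gP B BM.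
  case=> cd; apply/eqP/negPn/negP => AB.
  have /disjoint_setI0/setP/(_ c) := trivIsetP Mtriv A B AM BM AB.
  by rewrite !inE cA cd dB.
have mateC c d : c \in C -> d \in C -> c != mate d.
  by move=> cC dC; apply: contraTneq cC => ->; rewrite coverm ?matec // dC.
pose f c := [set c; mate c].
have f_disj c d : c \in C -> d \in C -> c != d -> [disjoint f c & f d].
  move=> cC dC cd; rewrite disjoints_subset; apply/subsetP => x.
  rewrite !inE => /orP[]/eqP->; rewrite negb_or.
    by rewrite cd mateC.
  by rewrite eq_sym mateC // (inj_eq (inv_inj invm)).
have f_inj : {in C &, injective f}.
  move=> c d cC dC fcd; apply/eqP; apply: contraT => /(f_disj _ _ cC dC).
  by rewrite fcd -setI_eq0 setIid => /eqP/setP/(_ d); rewrite !inE eqxx.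
rewrite -(card_in_imset f_inj); apply: (leq_bigmax_cond (f @: C)).
apply/andP; split.
  apply/subsetP => _ /imsetP[c cC ->]; apply/imsetP; exists (c, mate c) => //.
  by rewrite inE /= edgem ?matec.
apply/trivIsetP => _ _ /imsetP[c cC ->] /imsetP[d dC ->] cd.
by apply: f_disj => //; apply: contraNneq cd => ->.
Qed.

End Forest.

(** * Vanishing bounds obtained by splitting on variables *)

Section UpperBound.
Variables (K : fieldType) (n : nat) (rho : 'I_n -> nat).
Hypothesis rho_inj : injective rho.
Local Notation vanishes := (vanishes K rho).
Implicit Types (P : pred 'X_{1..n}) (A B C T : {set 'I_n}) (s : seq {set 'I_n}) (v y : 'I_n).

Definition mset B : 'X_{1..n} := [multinom (i \in B : nat) | i < n].

Lemma msetE B v : mset B v = (v \in B).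
Proof. exact: mnmE. Qed.

Lemma mset0 : mset set0 = 0%MM.
Proof. by apply/mnmP => v; rewrite msetE inE mnm0E. Qed.

Lemma msetU1 v B : v \notin B -> mset (v |: B) = (U_(v) + mset B)%MM.
Proof.
move=> vB; apply/mnmP => u; rewrite mnmDE mnm1E !msetE in_setU1 eq_sym.
by case: eqP => //= <-; rewrite (negPf vB).
Qed.

Lemma mdeg_mset B : mdeg (mset B) = #|B|.
Proof.
by rewrite mdegE -sum1_card [RHS]big_mkcond; apply: eq_bigr => i _; rewrite msetE; case: ifP.
Qed.

Definition divisible_by s : pred 'X_{1..n} :=
  fun m => has (fun T : {set 'I_n} => [forall u in T, (0 < m u)%N]) s.

Lemma divisible_by_up s : upclosed (divisible_by s).
Proof.
move=> m k /hasP[T Ts /forall_inP mT]; apply/hasP; exists T => //.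
by apply/forall_inP => u /mT mu; rewrite mnmDE addn_gt0 mu.
Qed.

Lemma colon_divisible_by s y :
  colon (divisible_by s) y =1 divisible_by [seq T :\ y | T : {set 'I_n} <- s].
Proof.
move=> m; rewrite /colon /divisible_by has_map; apply: eq_has => T /=.
apply/forall_inP/forall_inP => mT u.
  by rewrite !inE => /andP[uy /mT]; rewrite mnmDE mnm1E eq_sym (negPf uy) addn0.
move=> uT; rewrite mnmDE mnm1E; case: eqVneq => [_|uy]; first by rewrite addn1.
by rewrite addn0 mT // !inE uT eq_sym uy.
Qed.

Lemma plus_divisible_by s y :
  plus (divisible_by s) y =1 divisible_by ([set y] :: [seq T : {set 'I_n} <- s | y \notin T]).
Proof.
move=> m; rewrite /plus /divisible_by /= orbC.
have -> : [forall u in [set y], (0 < m u)%N] = (0 < m y)%N.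
  by apply/forall_inP/idP => [->|my u]; rewrite ?set11 // inE => /eqP->.
have [|my] := boolP (0 < m y)%N => //=.
apply/hasP/hasP => -[T]; rewrite ?mem_filter.
  move=> Ts mT; exists T; rewrite // mem_filter Ts andbT.
  by apply: contra my; apply: (forall_inP mT).
by case/andP=> _ Ts mT; exists T.
Qed.

(* The bound given by the Taylor resolution. *)
Lemma vanishes_divisible_by s d :
  (\sum_(T <- s) #|T|.-1 < d)%N -> vanishes (divisible_by s) d.
Proof.
have [k] := ubnP (\sum_(T <- s) #|T|.-1)%N; elim: k s d => // k IH s d sk.
case: d => // d sd.
(* Split on a variable of a generator of degree at least 2: the sum drops in both branches, which
   for (I : y) also compensates the drop of [d]. Without such a generator the ideal is the unit
   ideal or generated by variables. *)
have [/hasP[T0 T0s T0_big]|small] := boolP (has (fun T : {set 'I_n} => 1 < #|T|)%N s).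
  have /card_gt0P[y yT0] : (0 < #|T0|)%N by apply: leq_trans T0_big.
  have sumE (f : {set 'I_n} -> nat) : (\sum_(T <- s) f T = f T0 + \sum_(T <- rem T0 s) f T)%N.
    exact: big_rem.
  apply: (@vanishes_split _ _ _ rho_inj _ y); first exact: divisible_by_up.
    apply: eq_vanishes (fsym (colon_divisible_by s y)) _.
    suff lt_sum : (\sum_(T <- [seq T :\ y | T : {set 'I_n} <- s]) #|T|.-1 < \sum_(T <- s) #|T|.-1)%N.
      by apply: IH; apply: leq_trans lt_sum _.
    rewrite big_map !sumE -addSn leq_add //.
      by rewrite (cardsD1 y T0) yT0 in T0_big *; move: T0_big; case: #|_|.
    apply: leq_sum => T _; rewrite -!subn1 leq_sub2r // subset_leq_card ?subD1set //.
  apply: eq_vanishes (fsym (plus_divisible_by s y)) _.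
  suff lt_sum : (\sum_(T <- [set y] :: [seq T : {set 'I_n} <- s | y \notin T]) #|T|.-1 <
      \sum_(T <- s) #|T|.-1)%N.
    by apply: IH; [apply: leq_trans lt_sum _ | apply: ltn_trans lt_sum _].
  rewrite big_cons cards1 add0n big_filter big_mkcond !sumE yT0 add0n -addn1 addnC.
  by apply: leq_add; [case: #|T0| T0_big => [|[]] | apply: leq_sum => T _; case: ifP].
have [s0|s0] := boolP (set0 \in s).
  move=> z _ _; exists 0 => i j m; case/negP; apply/hasP; exists set0 => //.
  by apply/forall_inP => u; rewrite inE.
have small_hits := @vanishes_hits K n rho rho_inj [set v | [set v] \in s] d.
apply: eq_vanishes small_hits => m.
apply/exists_inP/hasP => [[v]|[T Ts /forall_inP mT]].
  rewrite inE => vs mv; exists [set v] => //; apply/forall_inP => u.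
  by rewrite inE => /eqP->.
have /cards1P[v TE] : #|T| == 1%N.
  rewrite eqn_leq card_gt0 leqNgt (hasPn small) //=.
  by apply: contraNneq s0 => <-.
by exists v; [rewrite inE -TE | apply: mT; rewrite TE set11].
Qed.

(** The ideal (I : x_B) + (x_v : v in A); for squarefree I this sets the variables of B to 1 and
    those of A to 0. *)
Definition specialize P A B : pred 'X_{1..n} := fun m => hits A m || P (m + mset B)%MM.

(** Each vertex of C goes into B, at the cost of one degree, or into A. The condition [#|C| < d]
    keeps [d - #|B|] positive throughout, as [vanishes_split] requires. *)
Lemma vanishes_specialize P C d : upclosed P -> (#|C| < d)%N ->
    (forall A B, A :|: B = C -> [disjoint A & B] ->
       vanishes (specialize P A B) (d - #|B|)) ->
  vanishes P d.
Proof.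
move=> Pup Cd H.
suff main k A B : [disjoint A & B] -> A :|: B \subset C -> (#|C :\: (A :|: B)| <= k)%N ->
    vanishes (specialize P A B) (d - #|B|).
  have := main #|C| set0 set0; rewrite cards0 subn0 => main0.
  apply: eq_vanishes _ (main0 _ _ _) => [m|||].
  - rewrite /specialize mset0 addm0 (_ : hits set0 m = false) //.
    by apply/exists_inP => -[v]; rewrite inE.
  - by rewrite -setI_eq0 set0I.
  - by rewrite setU0 sub0set.
  - by rewrite setU0 setD0.
elim: k A B => [|k IH] A B AB ABC Ck.
  apply: H => //; apply/eqP; rewrite eqEsubset ABC /=.
  by rewrite -setD_eq0 -cards_eq0 -leqn0.
have [CAB|/subsetPn[y yC]] := boolP (C \subset A :|: B).
  by apply: H => //; apply/eqP; rewrite eqEsubset ABC.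
rewrite inE negb_or => /andP[yA yB].
have Ck' : (#|C :\: (y |: (A :|: B))| <= k)%N.
  rewrite -ltnS; apply: leq_trans Ck; apply: proper_card.
  apply/properP; split; first by rewrite setDS // subsetUr.
  by exists y; rewrite !inE ?eqxx //= yC (negPf yA) (negPf yB).
have BC : (#|B|.+1 <= #|C|)%N.
  have := subset_leq_card (_ : y |: B \subset C); rewrite cardsU1 yB; apply.
  by rewrite subUset sub1set yC; apply: subset_trans ABC; apply: subsetUr.
have dE : (d - #|B| = (d - #|B|.+1).+1)%N by lia.
rewrite dE; apply: (@vanishes_split _ _ _ rho_inj _ y).
- move=> m k' /orP[/hits_up h|mP]; rewrite /specialize ?h //.
  by rewrite -addmA [(k' + _)%MM]addmC addmA Pup ?orbT.
- have -> : (#|B|.+1 = #|y |: B|)%N by rewrite cardsU1 yB.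
  apply: eq_vanishes _ (IH A (y |: B) _ _ _).
  + move=> m; rewrite /specialize /colon msetU1 // addmA; congr (_ || _).
    apply: eq_existsb => v; case vA: (v \in A) => //=.
    have /negPf yv : y != v by apply: contraTneq vA => <-.
    by rewrite mnmDE mnm1E yv addn0.
  + rewrite -setI_eq0 setIUr setU_eq0 (setI_eq0 A B) AB andbT setI_eq0 disjoint_sym.
    by rewrite disjoints1.
  + by rewrite setUCA subUset sub1set yC.
  + by rewrite setUCA.
rewrite -dE; apply: eq_vanishes _ (IH (y |: A) B _ _ _).
- by move=> m; rewrite /specialize /plus -plus_hits /plus orbAC.
- by rewrite -setI_eq0 setIUl setU_eq0 !setI_eq0 AB disjoints1 yB.
- by rewrite -setUA subUset sub1set yC.
- by rewrite -setUA.
Qed.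

End UpperBound.

(** * The closed neighborhood ideal and the upper bound on its regularity *)

Section ClosedNeighborhoods.
Variables (K : fieldType) (n : nat) (e : rel 'I_n).
Hypotheses (e_sym : ssrbool.symmetric e) (e_irr : irreflexive e).
Local Notation R := {mpoly K[n]}.
Local Notation N := #|{: {set 'I_n}}|.
Local Notation nbhd := (closed_nbhd e).
Implicit Types (u v w : 'I_n) (A B C Q : {set 'I_n}) (m : 'X_{1..n}).

Definition nbhd_divides : pred 'X_{1..n} :=
  fun m => [exists w, [forall u in nbhd w, (0 < m u)%N]].

Lemma in_nbhd w u : (u \in nbhd w) = (u == w) || e w u.
Proof. by rewrite !inE. Qed.

Lemma nbhd_refl w : w \in nbhd w.
Proof. by rewrite in_nbhd eqxx. Qed.

Lemma nbhd_divides_up : upclosed nbhd_divides.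
Proof.
move=> m k /existsP[w /forall_inP mw]; apply/existsP; exists w.
by apply/forall_inP => u /mw mu; rewrite mnmDE addn_gt0 mu.
Qed.

Lemma nbhd_divides0 : ~~ nbhd_divides 0%MM.
Proof.
apply/existsP => -[w /forall_inP/(_ w (nbhd_refl w))].
by rewrite mnm0E.
Qed.

Lemma nbhd_divides_mset B : nbhd_divides (mset B) = [exists w, nbhd w \subset B].
Proof.
apply: eq_existsb => w; apply/forall_inP/subsetP => h u /h; rewrite msetE; by case: (u \in B).
Qed.

Lemma nbhd_monomialE w : nbhd_monomial K e w = 'X_[mset (nbhd w)].
Proof.
rewrite /nbhd_monomial mprodXE; congr ('X_[_]); apply/mnmP => u.
rewrite msetE mnm_sumE; under eq_bigr do rewrite mnm1E.
have [uw|uw] := boolP (u \in nbhd w).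
  by rewrite (bigD1 u) //= eqxx big1 // => v /andP[_ /negPf ->].
by rewrite big1 // => v vw; case: eqP uw => // <-; rewrite vw.
Qed.

Lemma closed_nbhd_idealE f : closed_nbhd_ideal K e f <-> inI nbhd_divides f.
Proof.
split=> [[a ->]|fI].
  apply: (big_ind (inI nbhd_divides)); [exact: inI0 | exact: inID | move=> w _].
  apply: inIM => [|m]; first exact: nbhd_divides_up.
  apply: contraNeq; rewrite nbhd_monomialE mcoeffX.
  have [<- _|_] := eqVneq (mset (nbhd w)) m; last by rewrite eqxx.
  by rewrite nbhd_divides_mset; apply/existsP; exists w.
pose J := closed_nbhd_ideal K e.
have J0 : J 0 by exists (fun=> 0); rewrite big1 // => w _; rewrite mul0r.
have JD f1 f2 : J f1 -> J f2 -> J (f1 + f2).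
  move=> [a1 ->] [a2 ->]; exists (fun w => a1 w + a2 w).
  by rewrite -big_split; apply: eq_bigr => w _; rewrite mulrDl.
rewrite [f]mpolyE big_seq; apply: (big_ind J) => // m; rewrite mcoeff_msupp => fm.
have /existsP[w /forall_inP mw] : nbhd_divides m by apply: contraNT fm => /fI ->.
have le_wm : (mset (nbhd w) <= m)%MM.
  by apply/mnm_lepP => u; rewrite msetE; case: (boolP (u \in nbhd w)) => // /mw.
exists (fun v => if v == w then f@_m *: 'X_[m - mset (nbhd w)] else 0).
rewrite (bigD1 w) //= eqxx big1 ?addr0 => [|v /negPf ->]; last by rewrite mul0r.
by rewrite nbhd_monomialE -scalerAl -mpolyXD submK.
Qed.

Variables (C : {set 'I_n}) (mate : 'I_n -> 'I_n).
Hypothesis C_mate : matched_cover e setT C mate.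

Lemma nbhd_outside w : w \notin C -> nbhd w \subset w |: C.
Proof.
move=> wC; apply/subsetP => u; rewrite in_nbhd in_setU1; case: eqVneq => //= _ wu.
by have := cover_edge C_mate (in_setT w) (in_setT u) wu; rewrite (negPf wC).
Qed.

(* All but at most one of the outer neighbors p of w are children of w; the
   neighbor in [A] of such a p is then a child of p, which determines p and w. *)
Lemma count_nbhd_outside (par : 'I_n -> option 'I_n) A (W : {set 'I_n}) :
    (forall u v, e u v -> par u = Some v \/ par v = Some u) ->
    W \subset C -> [disjoint W & A] ->
    (forall w p, w \in W -> p \notin C -> e w p -> exists2 a, a \in A & e p a) ->
  (\sum_(w in W) #|nbhd w :\: C|.-1 <= #|A|)%N.
Proof.
move=> parP WC WA WP.
pose Y w := [set p | [&& p \notin C, e w p & par p == Some w]].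
have Yle w : w \in W -> (#|nbhd w :\: C|.-1 <= #|Y w|)%N.
  move=> wW; rewrite -subn1 leq_subLR.
  apply: leq_trans (_ : #|[set p | par w == Some p] :|: Y w| <= _)%N.
    apply/subset_leq_card/subsetP => p; rewrite !inE => /andP[pC /orP[/eqP pw|wp]].
      by rewrite pw (subsetP WC _ wW) in pC.
    by have [->|->] := parP _ _ wp; rewrite ?eqxx // pC wp orbT.
  apply: leq_trans (leq_card_setU _ _) _; rewrite leq_add2r.
  case: (par w) => [q|].
    apply: leq_trans (_ : #|[set q]| <= _)%N; last by rewrite cards1.
    by apply/subset_leq_card/subsetP => p; rewrite !inE => /eqP[->].
  by rewrite (_ : [set p | _] = set0) ?cards0 //; apply/setP => p; rewrite !inE.
apply: leq_trans (_ : \sum_(w in W) #|Y w| <= _)%N; first exact: leq_sum.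
under eq_bigr do rewrite -sum1_card.
rewrite pair_big_dep sum1dep_card /=.
(* [f] sends [a] to the pair (grandparent, parent), so its image on [A] is to contain every counted
   pair. *)
pose f a := obind (fun p => omap (fun w => (w, p)) (par p)) (par a).
apply: leq_trans (leq_imset_card f A).
have Some_inj : injective (@Some ('I_n * 'I_n)) by move=> ? ? [].
rewrite -(card_imset _ Some_inj); apply/subset_leq_card/subsetP => z /imsetP[[w p] + ->].
rewrite !inE /= => /andP[wW /and3P[pC wp /eqP par_p]].
have [a aA pa] := WP w p wW pC wp.
apply/imsetP; exists a => //; rewrite /f.
(* If [a] were the parent of [p], it would be [w], which is not in [A]. *)
have [par_p'|->] := parP p a pa; last by rewrite /= par_p.
have aw : a = w by move: par_p; rewrite par_p' => -[].
by rewrite -setI_eq0 in WA; move/eqP/setP/(_ w): WA; rewrite !inE wW -aw aA.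
Qed.

(** After specializing, the ideal is generated by the variables of [A :|: D], which add nothing to
    the degree sum, and by the products over [nbhd w :\: C] for w in [W], whose contribution
    [count_nbhd_outside] bounds by #|A|. *)
Lemma vanishes_nbhd (rho : 'I_n -> nat) d : injective rho -> is_forest e ->
  (#|C| < d)%N -> vanishes K rho nbhd_divides d.
Proof.
move=> rho_inj e_forest Cd.
have [par parP] := forest_parent e_sym e_irr e_forest.
apply: (vanishes_specialize rho_inj (C := C)) => //; first exact: nbhd_divides_up.
move=> A B ABC AB.
(* For w outside C whose neighborhood avoids A, all neighbors are in B, so the generator of w
   becomes x_w. *)
pose D := [set w | (w \notin C) && [disjoint nbhd w & A]].
(* For w in C the generator becomes the product over the outer neighbors. It is redundant if one of
   them is in [D]; excluding this case makes every closed neighborhood of an outer neighbor meet A,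
   as the counting requires. *)
pose W := [set w in C | [disjoint nbhd w & A] &&
  [forall p, (p \notin C) && e w p ==> ~~ [disjoint nbhd p & A]]].
pose s := [seq [set v] | v <- enum (A :|: D)] ++ [seq nbhd w :\: C | w <- enum W].
have CB u : u \in C -> u \notin A -> u \in B by rewrite -ABC inE => /orP[->|].
have BC u : u \in B -> u \in C by rewrite -ABC inE orbC => ->.
have WA : [disjoint W & A].
  rewrite -setI_eq0; apply/eqP/setP => w; rewrite !inE.
  apply/negP => /andP[/and3P[_ /pred0P/(_ w)]].
  by rewrite /= nbhd_refl /= => ->.
have s_small : (\sum_(T <- s) #|T|.-1 <= #|A|)%N.
  rewrite big_cat !big_map /= big1 ?add0n => [|v _]; last by rewrite cards1.
  rewrite big_enum /=; apply: (count_nbhd_outside parP) => //.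
    by apply/subsetP => w; rewrite inE => /andP[].
  move=> w p; rewrite inE => /and3P[wC _ /forallP/(_ p)] => wW pC wp.
  move: wW; rewrite pC wp /= => /pred0Pn[a /andP[/= pa aA]]; exists a => //.
  move: pa; rewrite in_nbhd => /orP[/eqP ap|//].
  by move: pC; rewrite -ap -ABC inE aA.
apply: eq_vanishes (vanishes_divisible_by rho_inj (s := s) (d := d - #|B|) _); last first.
  (* Since A and B partition C, [#|A| + #|B| = #|C| < d]. *)
  apply: leq_ltn_trans s_small _; have := leq_card_setU A B; rewrite AB ABC.
  move=> /leqifP; rewrite ?eqxx => /eqP; lia.
move=> m; apply/hasP/idP => [[T]|].
  rewrite mem_cat => /orP[] /mapP[w]; rewrite mem_enum => w_in -> /forall_inP mT; last first.
    move: w_in; rewrite inE => /and3P[_ wA _]; apply/orP; right.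
    apply/existsP; exists w; apply/forall_inP => u uw; rewrite mnmDE msetE addn_gt0.
    have [uC|uC] := boolP (u \in C); last by rewrite mT // inE uC.
    by rewrite CB ?orbT // (disjointFr wA uw).
  have mw : (0 < m w)%N by apply: mT; rewrite set11.
  have [wA|wA] := boolP (w \in A); first by apply/orP; left; apply/exists_inP; exists w.
  move: w_in; rewrite in_setU (negPf wA) inE => /andP[wC wA'].
  apply/orP; right; apply/existsP; exists w; apply/forall_inP => u uw.
  rewrite mnmDE msetE addn_gt0; have [->|uC] := setU1P (subsetP (nbhd_outside wC) u uw).
    by rewrite mw.
  by rewrite CB ?orbT // (disjointFr wA' uw).
have set1_s v : v \in A :|: D -> (0 < m v)%N ->
    exists2 T : {set 'I_n}, T \in s & [forall u in T, (0 < m u)%N].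
  move=> vAD mv; exists [set v]; last by apply/forall_inP => u; rewrite inE => /eqP->.
  by rewrite mem_cat map_f ?mem_enum.
case/orP => [/exists_inP[v vA mv]|/existsP[w /forall_inP mw]].
  by apply: (set1_s v); rewrite // inE vA.
have {}mw u : u \in nbhd w -> u \notin B -> (0 < m u)%N.
  by move=> uw /negPf uB; move: (mw u uw); rewrite mnmDE msetE uB addn0.
have CNB u : u \notin C -> u \notin B by apply: contra; apply: BC.
have [wA|/pred0Pn[a /andP[/= aw aA]]] := boolP [disjoint nbhd w & A]; last first.
  by apply: (set1_s a); rewrite ?inE ?aA // mw // (disjointFr AB aA).
have [wC|wC] := boolP (w \in C); last first.
  by apply: (set1_s w); [rewrite !in_setU inE wC wA !orbT | apply: mw; rewrite ?nbhd_refl ?CNB].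
have [wW|/forallPn[p]] := boolP [forall p, (p \notin C) && e w p ==> ~~ [disjoint nbhd p & A]].
  exists (nbhd w :\: C).
    rewrite mem_cat; apply/orP; right; apply/mapP; exists w => //.
    by rewrite mem_enum inE wC wA.
  by apply/forall_inP => u; rewrite inE => /andP[uC uw]; apply: mw; rewrite ?CNB.
rewrite negb_imply negbK => /andP[/andP[pC wp] pA].
by apply: (set1_s p); [rewrite in_setU inE pC pA orbT | apply: mw; rewrite ?CNB // in_nbhd wp orbT].
Qed.

(* [v] and [mate v] are consecutive for [mate_rank], so that exchanging them in
   a face flips the Koszul sign. *)
Definition mate_rank v : nat := (2 * minn v (mate v) + (mate v < v))%N.

Lemma mate_rank_inj : injective mate_rank.
Proof.
move=> v u; rewrite /mate_rank => E.
have [/val_inj//|/val_inj/(inv_inj (mate_inv C_mate))//] :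
  v = u :> nat \/ mate v = mate u :> nat by lia.
Qed.

(** * The cross-polytope cocycle for the lower bound *)

Local Notation koszul := (koszul K mate_rank).
Local Notation sgn := (ksgn K mate_rank).

(** One vertex of each matched pair and all unmatched vertices: the facets of a cross-polytope
    joined with a simplex. *)
Definition transversal Q := [forall v, (v \in Q) (+) ((mate v \in Q) && (mate v != v))].

Lemma transversal_setC : transversal (~: C).
Proof.
apply/forallP => v; rewrite !inE; have [mv|mv] /= := eqVneq (mate v) v.
  by rewrite andbF addbF; apply: contra_eqN mv; apply: (cover_mate C_mate).
by rewrite andbT (mate_cover C_mate mv) negbK; case: (v \in C).
Qed.

(** A vertex outside Q has its mate as a neighbor in Q, so no closed neighborhood avoids Q. *)
Lemma transversal_dominates Q : transversal Q -> ~~ nbhd_divides (mset (~: Q)).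
Proof.
move=> /forallP tQ; rewrite nbhd_divides_mset; apply/existsP => -[w /subsetP wQ].
have /negPf wNQ : w \notin Q by rewrite -in_setC wQ ?nbhd_refl.
have := tQ w; rewrite wNQ /= => /andP[mwQ mw].
have : mate w \in ~: Q by apply: wQ; rewrite in_nbhd (mate_edge C_mate mw) orbT.
by rewrite inE mwQ.
Qed.

(** For a transversal Q missing v, the face [v |: Q] contains both v and [mate v]. Deleting [mate v]
    instead of v gives the other transversal in this face; [flip] exchanges the two. *)
Definition flip (x : {set 'I_n} * 'I_n) := ((x.2 |: x.1) :\ mate x.2, mate x.2).

Definition cofacet (x : {set 'I_n} * 'I_n) := transversal x.1 && (x.2 \notin x.1).

Lemma cofacet_mate x : cofacet x -> (mate x.2 \in x.1) && (mate x.2 != x.2).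
Proof. by case/andP => /forallP/(_ x.2) + /negPf xN; rewrite xN. Qed.

Lemma flipK x : cofacet x -> flip (flip x) = x.
Proof.
case: x => Q v xc; have /andP[/= mQ mv] := cofacet_mate xc; have /andP[_ /= vQ] := xc.
rewrite /flip /= (mate_inv C_mate); congr (_, _); rewrite setD1K; first by rewrite setU1K.
by rewrite in_setU1 mQ orbT.
Qed.

Lemma flip_cofacet x : cofacet x -> cofacet (flip x).
Proof.
case: x => Q v xc; have /andP[/= mQ mv] := cofacet_mate xc.
have /andP[/= /forallP tQ vQ] := xc; have invm := mate_inv C_mate.
rewrite /cofacet /flip /= !inE eqxx /= andbT; apply/forallP => u; rewrite !inE.
have [->|uv] := eqVneq u v; first by rewrite eq_sym mv eqxx.
have [->|um] := eqVneq u (mate v); first by rewrite invm eqxx eq_sym mv.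
have -> : (mate u == mate v) = false by rewrite (inj_eq (inv_inj invm)) (negPf uv).
have -> : (mate u == v) = false by apply: contraNF um => /eqP <-; rewrite invm.
exact: tQ.
Qed.

(** Over the common part [Q0], v and [mate v] have the same sign because their ranks are
    consecutive; exactly one of them gets a further -1 from the other. *)
Lemma ksgn_flip x : cofacet x -> sgn (flip x).2 (flip x).1 = - sgn x.2 x.1.
Proof.
case: x => Q v xc; have /andP[/= mQ mv] := cofacet_mate xc; have /andP[_ /= vQ] := xc.
have invm := mate_inv C_mate.
pose Q0 := Q :\ mate v.
have vQ0 : v \notin Q0 by rewrite inE negb_and vQ orbT.
have mQ0 : mate v \notin Q0 by rewrite setD11.
rewrite /flip /=; have -> : (v |: Q) :\ mate v = v |: Q0.
  by apply/setP => u; rewrite !inE; have [->|_] //= := eqVneq u v; rewrite eq_sym mv.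
rewrite -[in RHS](setD1K mQ) -/Q0 !ksgnU //.
have same : sgn (mate v) Q0 = sgn v Q0.
  rewrite /ksgn; congr (_ ^+ _); apply: eq_card => u; rewrite !inE; case: eqVneq => //= um.
  case uQ: (u \in Q) => //=.
  have uv : u != v by apply: contraNneq vQ => <-; rewrite uQ.
  have := inj_eq mate_rank_inj u v; have := inj_eq mate_rank_inj u (mate v).
  rewrite (negPf uv) (negPf um) /mate_rank invm.
  by case: (ltngtP v (mate v)) => [||/val_inj vm]; [lia | lia | rewrite -vm eqxx in mv].
have : (mate_rank (mate v) < mate_rank v)%N = ~~ (mate_rank v < mate_rank (mate v))%N.
  by rewrite -leqNgt [RHS]leq_eqVlt (inj_eq mate_rank_inj) (negPf mv).
move=> ->; rewrite same.
by case: ltnP => _; rewrite /= ?expr0 ?expr1 ?mul1r ?mulN1r ?opprK.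
Qed.

(** The cocycle condition: the terms of the boundary are indexed by pairs (Q, v) with v outside Q,
    and [flip] is a sign-reversing involution on these pairs. *)
Lemma sum_cofacets_eq0 (w : 'cV[R]_N) :
  \sum_(Q | transversal Q) ((koszul *m w) (enum_rank Q) 0)@_(mset (~: Q)) = 0.
Proof.
pose F (x : {set 'I_n} * 'I_n) : K :=
  (sgn x.2 x.1 * w (enum_rank (x.2 |: x.1)) 0)@_(mset (~: (x.2 |: x.1))).
transitivity (\sum_(x | cofacet x) F x).
  rewrite -(pair_big_dep transversal (fun Q v => v \notin Q) (fun Q v => F (Q, v))) /=.
  apply: eq_bigr => Q _; rewrite koszulE raddf_sum /=; apply: eq_bigr => v vQ.
  rewrite -mulrA mulrCA mcoeffMvar msetE inE vQ /=; congr (_@__).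
  apply/mnmP => u; rewrite mnmBE mnm1E !msetE !inE eq_sym.
  by case: eqVneq => [->|_]; rewrite ?vQ // subn0.
have F_flip x : cofacet x -> F (flip x) = - F x.
  move=> xc; rewrite /F ksgn_flip // mulNr mcoeffN.
  congr (- (_ * w (enum_rank _) 0)@_(mset (~: _))).
    have /andP[mQ mv] := cofacet_mate xc; rewrite setD1K //; by rewrite in_setU1 mQ orbT.
  have /andP[mQ mv] := cofacet_mate xc; rewrite setD1K //; by rewrite in_setU1 mQ orbT.
(* [flip] exchanges the pairs with [v < mate v] and those with [mate v < v]. *)
rewrite (bigID (fun x : {set 'I_n} * 'I_n => x.2 < mate x.2)%N) /=.
rewrite [X in _ + X](reindex_onto flip flip) => [|x /andP[/flipK]] //=.
rewrite [X in _ + X](eq_bigl (fun x : {set 'I_n} * 'I_n => cofacet x && (x.2 < mate x.2)%N)) => [|x].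
  by rewrite -big_split big1 //= => x /andP[xc _]; rewrite F_flip // subrr.
rewrite (mate_inv C_mate) -leqNgt.
apply/idP/idP => [/andP[/andP[fc le_m] /eqP fK]|/andP[xc lt_m]].
  have xc := flip_cofacet fc; rewrite fK in xc; rewrite xc ltn_neqAle le_m andbT.
  by have /andP[_] := cofacet_mate xc; apply: contra_neq => /val_inj.
by rewrite flip_cofacet // flipK // eqxx ltnW.
Qed.

Definition cover_cycle : 'cV[R]_N :=
  \matrix_(i, j) if i == enum_rank (~: C) then 'X_[mset C] else 0.

Lemma cover_cycleE Q : cover_cycle (enum_rank Q) 0 = if Q == ~: C then 'X_[mset C] else 0.
Proof. by rewrite mxE (inj_eq enum_rank_inj). Qed.

(** Up to sign the terms of the boundary are x_C x_v e_(V - C - v) with v outside C, and all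
    neighbors of such a v lie in the cover. *)
Lemma cover_cycle_mod : modI nbhd_divides (koszul *m cover_cycle).
Proof.
move=> i j; rewrite ord1 -(enum_valK i); move: (enum_val i) => Q.
rewrite koszulE; apply: (big_ind (inI nbhd_divides)); [exact: inI0 | exact: inID |].
move=> v vQ; rewrite cover_cycleE -mulrA; case: eqP => [vQC|_]; last by rewrite !mulr0; apply: inI0.
apply: inIM => [|m]; first exact: nbhd_divides_up.
have vC : v \notin C by rewrite -in_setC -vQC setU11.
rewrite -mpolyXD -msetU1 // mcoeffX; have [<-|_] := eqVneq (mset (v |: C)) m => //.
by rewrite nbhd_divides_mset => /existsP[]; exists v; apply: nbhd_outside.
Qed.

(** The functional of [sum_cofacets_eq0] vanishes on boundaries and, by [transversal_dominates], on
    chains with coefficients in NI(G), but it is 1 on [cover_cycle]. *)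
Lemma cover_cycle_nonboundary :
  ~ exists w : 'cV[R]_N, modI nbhd_divides (cover_cycle - koszul *m w).
Proof.
move=> [w wP].
have : \sum_(Q | transversal Q)
    ((cover_cycle - koszul *m w) (enum_rank Q) 0)@_(mset (~: Q)) = 0.
  by apply: big1 => Q tQ; apply: wP; apply: transversal_dominates.
have subE (A B : 'cV[R]_N) i m : ((A - B) i 0)@_m = (A i 0)@_m - (B i 0)@_m.
  by rewrite !mxE mcoeffB.
under eq_bigr do rewrite subE.
rewrite sumrB sum_cofacets_eq0 subr0 /=.
rewrite (bigD1 (~: C)) ?transversal_setC //= big1.
  by rewrite cover_cycleE eqxx setCK mcoeffX eqxx addr0 => /eqP; rewrite oner_eq0.
by move=> Q /andP[_ /negPf QC]; rewrite cover_cycleE QC mcoeff0.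
Qed.

End ClosedNeighborhoods.

Theorem theorem1p1 (K : fieldType) (n : nat) (e : rel 'I_n)
    (e_sym : ssrbool.symmetric e) (e_irr : irreflexive e) (e_forest : is_forest e) :
  is_regularity (closed_nbhd_ideal K e) (Posz (matching_number e)).
Proof.
have [C [mate C_mate]] := forest_matched_cover e_sym e_irr e_forest.
have rho_inj := mate_rank_inj C_mate.
have I_P := @closed_nbhd_idealE K n e.
have P_up := @nbhd_divides_up n e.
rewrite (matching_number_cover C_mate).
split; first exact: min_free_resolution_exists P_up I_P (nbhd_divides0 e).
move=> F; split; last first.
  apply: (betti_le_vanishes rho_inj P_up I_P) => d Cd.
  exact: (vanishes_nbhd e_sym e_irr C_mate).
(* The class of x_C e_(V - C) has homological degree #|V - C| and internal degree n. *)
exists #|~: C|, (#|C|%:Z + #|~: C|%:Z); split; last by rewrite addrK.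
apply: (@betti_neq0_cycle _ _ _ rho_inj _ _ P_up I_P F _ _ (cover_cycle K C)).
- move=> i; rewrite -(enum_valK i) cover_cycleE; case: ifP => _; last exact: in_degree0.
  by rewrite -mdeg_mset; apply: in_degreeX.
- apply: chainP => Q l; rewrite hdegE ord1 cover_cycleE; case: eqP => // QC.
  by case: eqP => // QE; case: QC; rewrite QE.
- exact: cover_cycle_mod.
exact: cover_cycle_nonboundary.
Qed.
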